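(* The map $\omega\mapsto u^\ast(\omega,\cdot)\in L^2(D)$, where $u^\ast(\omega,\cdot)$ denotes the unique solution of the optimal control problem $$\min_{u\in U_{ad}} J_\omega(u):=\tfrac12\|S_\omega u-z\|_{L^2(D)}^2+\tfrac{\alpha}{2}\|u\|_{L^2(D)}^2 ,$$ is measurable.
   Context: $(\Omega,\mathcal{A},\mathbb{P})$ is a probability space and $D\subset\mathbb{R}^d$, $d\in\{1,2,3\}$, is a bounded convex polyhedral domain (with Lipschitz boundary). $a:\Omega\times\overline D\to\mathbb{R}$ is a random field, $a_\omega:=a(\omega,\cdot)$, $a_{\min}(\omega):=\min_{x\in\overline D}a(\omega,x)$, $a_{\max}(\omega):=\max_{x\in\overline D}a(\omega,x)$; $\mathcal{A}$ is the $\sigma$-algebra generated by the random variables $\{a(\cdot,x):x\in D\}$. For a Banach space $X$, $L^p(\Omega,X)$ is the Bochner space of strongly measurable $v:\Omega\to X$ with finite norm $(\int_\Omega\|v\|_X^p\,d\mathbb{P})^{1/p}$; $L^p(\Omega):=L^p(\Omega,\mathbb{R})$. Standing assumptions: (A1) $a_{\min}\ge 0$ almost surely and $a_{\min}^{-1}\in L^p(\Omega)$ for all $p\in[1,\infty)$; (A2) for some $0<t\le1$, $a\in L^p(\Omega,C^t(\overline D))$ for all $p\in[1,\infty)$ (Hölder space for $t<1$, $C^1(\overline D)$ for $t=1$). In particular $0<a_{\min}(\omega)\le a_{\max}(\omega)<\infty$ for a.e. $\omega$. For such $\omega$ and $u\in L^2(D)$, $S_\omega u:=y_\omega\in H^1_0(D)$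 denotes the unique weak solution of $\int_D a_\omega\nabla y_\omega\cdot\nabla v\,dx=\int_D uv\,dx$ for all $v\in H_0^1(D)$. The admissible set is $U_{ad}:=\{u\in L^2(D):u_a\le u(x)\le u_b\text{ a.e. in }D\}$ with given $-\infty\le u_a\le u_b\le\infty$, assumed non-empty; $z\in L^2(D)$ and the real number $\alpha>0$ are given and deterministic. For each $\omega$ for which $S_\omega$ is defined, the minimization problem has a unique solution. On the exceptional null set $\{a_{\min}\le 0\}$, $u^\ast(\omega,\cdot)$ is set equal to an arbitrary fixed element of $U_{ad}$. Measurability is with respect to $\mathcal{A}$ and the Borel $\sigma$-algebra of $L^2(D)$. *)

(* Defs.v *)
From HB Require Import structures.
From mathcomp Require Import all_boot all_order all_algebra.
From mathcomp Require Import all_classical all_reals all_analysis measurable_realfun.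

Set Implicit Arguments.
Unset Strict Implicit.
Unset Printing Implicit Defensive.

Import Order.TTheory GRing.Theory Num.Theory.
Import numFieldNormedType.Exports.

Local Open Scope classical_set_scope.
Local Open Scope ring_scope.

(* 'rV[R]_d carries the sigma-algebra generated by the coordinates, as the
   library does for d.-tuple R; it is the Borel sigma-algebra of R^d. *)
Fact rV_display : measure_display. Proof. exact: default_measure_display. Qed.

Section measurable_rV.
Context (R : realType) (d : nat).

Definition rV_coord (i : 'I_d) (x : 'rV[R]_d) : measurableTypeR R := x ord0 i.

Let rV_set0 : g_sigma_preimage rV_coord set0.
Proof. exact: sigma_algebra0. Qed.

Let rV_setC A : g_sigma_preimage rV_coord A -> g_sigma_preimage rV_coord (~` A).
Proof. exact: sigma_algebraC. Qed.

Let rV_bigcup (F : (set 'rV[R]_d)^nat) :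
  (forall i, g_sigma_preimage rV_coord (F i)) ->
  g_sigma_preimage rV_coord (\bigcup_i (F i)).
Proof. exact: sigma_algebra_bigcup. Qed.

HB.instance Definition _ := @isMeasurable.Build rV_display 'rV[R]_d
  (g_sigma_preimage rV_coord) rV_set0 rV_setC rV_bigcup.

Lemma measurable_coord (i : 'I_d) :
  measurable_fun [set: 'rV[R]_d] (fun x : 'rV[R]_d => x ord0 i).
Proof.
move=> _ Y mY; rewrite setTI; apply: sub_sigma_algebra => /=.
rewrite -bigcup_seq/=; exists i => /=; first by rewrite mem_index_enum.
by exists Y => //; rewrite setTI.
Qed.

End measurable_rV.

Lemma measurable_fun_rV (R : realType) (d : nat) dT (T : measurableType dT)
    (f : T -> 'rV[R]_d) :
  (forall i, measurable_fun [set: T] (fun x => f x ord0 i)) ->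
  measurable_fun [set: T] f.
Proof.
move=> mf _ Y mY; rewrite setTI.
pose S : set (set 'rV[R]_d) := [set A | measurable (f @^-1` A)].
suff : g_sigma_preimage (@rV_coord R d) `<=` S by move/(_ Y mY).
apply: smallest_sub.
  split => /=.
  - by rewrite /S /= preimage_set0.
  - by move=> A; rewrite /S /= setTD; exact: measurableC.
  - by move=> F mF; rewrite /S /= preimage_bigcup; exact: bigcupT_measurable.
move=> A; rewrite -bigcup_seq => -[i _ [B mB <-]]; rewrite /S /= setTI.
by have := mf i measurableT B mB; rewrite setTI.
Qed.

Definition rV_cons (R : realType) (d : nat) (p : R * 'rV[R]_d) : 'rV[R]_d.+1 :=
  row_mx (const_mx p.1 : 'rV[R]_1) p.2.

Lemma measurable_rV_cons (R : realType) (d : nat) :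
  measurable_fun [set: measurableTypeR R * 'rV[R]_d] (@rV_cons R d).
Proof.
apply: measurable_fun_rV => i; rewrite /rV_cons.
have [j ->|j ->] := @split_ordP 1 d i.
  under eq_fun do rewrite (row_mxEl (const_mx _ : 'rV_1)) mxE.
  exact: measurable_fst.
under eq_fun do rewrite (row_mxEr (const_mx _ : 'rV_1)).
exact: (measurableT_comp (measurable_coord j) measurable_snd).
Qed.

Definition lebesgue_step (R : realType) (d : nat)
    (m : {measure set 'rV[R]_d -> \bar R}) : set 'rV[R]_d.+1 -> \bar R :=
  pushforward (lebesgue_measure \x^ m)%E (@rV_cons R d).

HB.instance Definition _ (R : realType) (d : nat)
    (m : {measure set 'rV[R]_d -> \bar R}) :=
  Measure.copy (lebesgue_step m)
    (measure_function_pushforward__canonical__measure_function_Measure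
      (lebesgue_measure \x^ m)%E (@measurable_rV_cons R d)).

(* The product measure of d copies of the Lebesgue measure of R. *)
Fixpoint lebesgue_rV (R : realType) (d : nat) :
    {measure set 'rV[R]_d -> \bar R} :=
  match d with
  | 0 => \d_(0 : 'rV[R]_0)
  | n.+1 => lebesgue_step (lebesgue_rV R n)
  end.

(* A nonempty bounded intersection of finitely many open half-spaces, i.e. the
   interior of a convex polytope; its boundary is automatically Lipschitz. *)
Definition convex_polyhedral_domain (R : realType) (d : nat)
    (D : set 'rV[R]_d) : Prop :=
  [/\ D !=set0, bounded_set D &
    exists (m : nat) (N : 'M[R]_(m, d)) (b : 'cV[R]_m),
      D = [set x | forall i, (N *m x^T) i ord0 < b i ord0]].

Lemma measurable_polyhedral_domain (R : realType) (d : nat)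
    (D : set 'rV[R]_d) :
  convex_polyhedral_domain D -> measurable D.
Proof.
move=> [_ _ [m [N [b ->]]]].
pose f i (x : 'rV[R]_d) : R := \sum_j N i j * x ord0 j.
have mf i : measurable_fun setT (f i).
  by apply: measurable_sum => j; apply: measurable_funM => //;
    exact: measurable_coord.
rewrite (_ : [set x | _] = \bigcap_(i in [set: 'I_m])
    (f i @^-1` `]-oo, b i ord0[)); last first.
  apply/seteqP; split=> x /= h i.
    move=> _; rewrite /= in_itv /= /f; have := h i; rewrite mxE.
    by under eq_bigr do rewrite mxE.
  have := h i I; rewrite /= in_itv /= /f mxE.
  by under [X in _ -> X < _]eq_bigr do rewrite mxE.
apply: fin_bigcap_measurable => // i _.
by rewrite -[X in measurable X]setTI; exact: mf.
Qed.

Section L2.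
Context (R : realType) (d : nat) (D : set 'rV[R]_d).
Hypothesis hD : convex_polyhedral_domain D.

Definition lebesgue_on : set 'rV[R]_d -> \bar R :=
  mrestr (lebesgue_rV R d) (measurable_polyhedral_domain hD).

HB.instance Definition _ := Measure.on lebesgue_on.

(* Classes of functions on R^d up to equality a.e. in D. *)
Definition L2 : Type := LspaceType lebesgue_on (lee1n 2).

HB.instance Definition _ := gen_eqMixin L2.
HB.instance Definition _ := gen_choiceMixin L2.

Definition L2norm (f : 'rV[R]_d -> R) : R :=
  fine ('N[lebesgue_on]_(2%:E) [EFin \o f])%E.

Definition L2open (U : set L2) : Prop :=
  forall u, U u -> exists2 e, 0 < e &
    forall v : L2, L2norm (v \- u) < e -> U v.

Definition L2borel : set (set L2) := <<s [set U | L2open U] >>.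

End L2.

Section Sobolev.
Context (R : realType) (d : nat).
Implicit Type D : set 'rV[R]_d.

Definition partial (i : 'I_d) (f : 'rV[R]_d -> R) (x : 'rV[R]_d) : R :=
  'D_(delta_mx ord0 i) f x.

Definition smooth (f : 'rV[R]_d -> R) : Prop :=
  forall s : seq 'I_d, continuous (foldr partial f s) /\
    forall i x, derivable (foldr partial f s) x (delta_mx ord0 i).

(* C_c^oo(D), each function being extended by zero to R^d. *)
Definition test_function D (phi : 'rV[R]_d -> R) : Prop :=
  [/\ smooth phi, compact (closure [set x | phi x != 0]) &
      closure [set x | phi x != 0] `<=` D].

Variable D : set 'rV[R]_d.
Hypothesis hD : convex_polyhedral_domain D.
Local Notation L2 := (L2 hD).
Local Notation mu := (lebesgue_rV R d).

Definition is_weak_partial (i : 'I_d) (y g : L2) : Prop :=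
  forall phi, test_function D phi ->
    \int[mu]_(x in D) (y x * partial i phi x) =
    - \int[mu]_(x in D) (g x * phi x).

Definition H1 : set L2 := [set y | forall i, exists g, is_weak_partial i y g].

(* The weak derivative is unique in L^2(D); the default value y is only used
   when there is none. *)
Definition weak_partial (i : 'I_d) (y : L2) : L2 :=
  xget y [set g | is_weak_partial i y g].

(* The closure of C_c^oo(D) in H^1(D). *)
Definition H10 : set L2 := [set y | H1 y /\
  exists phi : nat -> 'rV[R]_d -> R,
    [/\ forall n, test_function D (phi n),
        L2norm hD (y \- phi n) @[n --> \oo] --> 0 &
        forall i, L2norm hD (weak_partial i y \- partial i (phi n))
          @[n --> \oo] --> 0]].

Definition weak_solution (a : 'rV[R]_d -> R) (u y : L2) : Prop :=
  H10 y /\ forall v, H10 v ->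
    \int[mu]_(x in D)
      (a x * \sum_(i < d) weak_partial i y x * weak_partial i v x) =
    \int[mu]_(x in D) (u x * v x).

(* The default value u is only used when there is no weak solution. *)
Definition solution_operator (a : 'rV[R]_d -> R) (u : L2) : L2 :=
  xget u [set y | weak_solution a u y].

Definition admissible (ua ub : \bar R) : set L2 :=
  [set u | {ae lebesgue_on hD, forall x, (ua <= (u x)%:E <= ub)%E}].

Definition cost (a : 'rV[R]_d -> R) (z : L2) (alpha : R) (u : L2) : R :=
  2^-1 * L2norm hD (solution_operator a u \- z) ^+ 2 +
  alpha / 2 * L2norm hD u ^+ 2.

Definition optimal_control (ua ub : \bar R) (a : 'rV[R]_d -> R) (z : L2)
    (alpha : R) (u : L2) : Prop :=
  admissible ua ub u /\
  forall v, admissible ua ub v -> cost a z alpha u <= cost a z alpha v.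

End Sobolev.

Section Hoelder.
Context (R : realType) (d : nat) (D : set 'rV[R]_d).

Definition enorm (x : 'rV[R]_d) : R := Num.sqrt (\sum_i x ord0 i ^+ 2).

Definition sup_norm (K : set 'rV[R]_d) (f : 'rV[R]_d -> R) : \bar R :=
  ereal_sup [set `|f x|%:E | x in K].

Definition hoelder_seminorm (t : R) (f : 'rV[R]_d -> R) : \bar R :=
  ereal_sup [set r | exists x y, [/\ closure D x, closure D y, x != y &
    r = (`|f x - f y| / enorm (x - y) `^ t)%:E]].

(* For t = 1 the supremum of a derivative over D is that of its continuous
   extension to closure D. *)
Definition Ct_norm (t : R) (f : 'rV[R]_d -> R) : \bar R :=
  (if (t < 1)%R then sup_norm (closure D) f + hoelder_seminorm t f
   else sup_norm (closure D) f + \sum_(i < d) sup_norm D (partial i f))%E.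

(* Functions are defined on R^d, but only their values on closure D matter. *)
Definition Ct_space (t : R) : set ('rV[R]_d -> R) := [set f |
  [/\ {within closure D, continuous f},
      t < 1 -> (hoelder_seminorm t f < +oo)%E &
      t = 1 -> forall i, exists2 g : 'rV[R]_d -> R,
        {within closure D, continuous g} &
        forall x, D x ->
          derivable f x (delta_mx ord0 i) /\ partial i f x = g x]].

(* The minimum over closure D when a is continuous there. *)
Definition amin (a : 'rV[R]_d -> R) : R := inf [set a x | x in closure D].

(* In \bar R, where 0^-1 = +oo (in R, 0^-1 = 0). *)
Definition amin_inv (a : 'rV[R]_d -> R) : \bar R := ((amin a)%:E^-1)%E.

End Hoelder.

(* The Banach space is given as the set X of elements of V on which the
   extended seminorm N is finite, up to N (v - w) = 0. *)
Section Bochner.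
Context (R : realType) (dT : measure_display) (T : measurableType dT).
Context (P : probability T R) (V : zmodType) (X : set V) (N : V -> \bar R).

Definition simple_map (s : T -> V) : Prop :=
  [/\ finite_set (range s), range s `<=` X &
      forall c, measurable (s @^-1` [set c])].

Definition strongly_measurable (v : T -> V) : Prop :=
  exists2 s : nat -> T -> V, (forall n, simple_map (s n)) &
    {ae P, forall w, N (v w - s n w) @[n --> \oo] --> 0%E}.

Definition bochner (p : R) (v : T -> V) : Prop :=
  [/\ forall w, X (v w), strongly_measurable v &
      ('N[P]_(p%:E) [N \o v] < +oo)%E].

End Bochner.

(* Main.v *)
From HB Require Import structures.
Require Import Defs.
From mathcomp Require Import all_boot all_order all_algebra.
From mathcomp Require Import all_classical all_reals all_analysis measurable_realfun.
From mathcomp Require Import ring lra.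

(** The optimal control depends continuously on the coefficient: by
    Lax-Milgram (Poincare inequality on [H^1_0(D)] and the Riesz
    representation of the energy form) [S_w] is a linear operator which is
    Lipschitz in [a_w] for the sup-norm, and the midpoint convexity gap of the
    quadratic term [alpha / 2 |u|^2] turns closeness of the costs into closeness
    of their minimizers.  Hence the preimage of an open set is open for the
    sup-norm of the coefficients.  By separability of the continuous functions
    it is a countable union of sets defined by the values of [a_w] at the
    rational points of [D], which are measurable; on the exceptional set
    [u^*] is constant. *)

(** The data are measurable only through the real functions [a ^~ x] with [x] in D, so no measurable
    map into a space of coefficients is formed; dependence on w is reduced to inequalities at
    countably many points. Continuity comes from comparing both costs at both minimizers: if u
    minimizes J_a and v minimizes J_b, then alpha/4 |u - v|^2 <= J_a(v) - J_a(u) <= |J_a - J_b|(v) +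
    |J_a - J_b|(u), because J_b(v) <= J_b(u). Estimating J_a - J_b takes a bound of |v| and an
    ellipticity constant valid for all b near a: the first follows from J_b(v) <= J_b(u), the second
    from admitting only perturbations of at most half the ellipticity constant of a. Weak
    derivatives and weak solutions are picked by [xget], so their linearity is a consequence of
    uniqueness: by the du Bois-Reymond lemma for derivatives, which calls for explicit test
    functions, and by coercivity for solutions. The dimension is written [d.+1] in the Poincare
    inequality and in what depends on it, because that inequality integrates along the first
    coordinate. *)

Set Implicit Arguments.
Unset Strict Implicit.
Unset Printing Implicit Defensive.

Import Order.TTheory GRing.Theory Num.Theory.
Import numFieldNormedType.Exports.

Local Open Scope classical_set_scope.
Local Open Scope ring_scope.

(** * Square integrable functions *)

Section square_integrable.
Context d (T : measurableType d) (R : realType) (mu : {measure set T -> \bar R}).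
Local Notation L := (Lfun mu 2%:E).
Implicit Types f g h m : T -> R.

Lemma Lfun2P f : f \in L <->
  measurable_fun [set: T] f /\ (\int[mu]_x (f x ^+ 2)%:E < +oo)%E.
Proof.
split=> [fL|[mf foo]].
  have mf : measurable_fun [set: T] f.
    by move: fL; rewrite inE => /andP[]; rewrite inE.
  split=> //; have /integrableP[_] := Lfun2_integrable_sqr fL.
  by under eq_integral do rewrite /= ger0_norm ?sqr_ge0//.
rewrite inE; apply/andP; split; rewrite inE//=.
rewrite /finite_norm unlock /= poweR_lty//.
apply: le_lt_trans foo; rewrite le_eqVlt; apply/orP; left; apply/eqP.
apply: eq_integral => x _.
by rewrite /= powR_mulrn// real_normK ?num_real.
Qed.

Lemma Lfun2_measurable f : f \in L -> measurable_fun [set: T] f.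
Proof. by move=> /Lfun2P[]. Qed.

Lemma Lfun2_comb c f g : f \in L -> g \in L -> (fun x => c * f x + g x) \in L.
Proof.
move=> fL gL; have [_] := Lfun_submod_closed mu (lee1n 2).
by move=> /(_ c f g fL gL).
Qed.

Lemma Lfun2_0 : (fun=> 0 : R) \in L.
Proof. by have [] := Lfun_submod_closed mu (lee1n 2). Qed.

Lemma Lfun2_scale c f : f \in L -> (fun x => c * f x) \in L.
Proof.
move=> fL; have := Lfun2_comb c fL Lfun2_0.
by under eq_fun do rewrite addr0.
Qed.

Lemma Lfun2D f g : f \in L -> g \in L -> f \+ g \in L.
Proof.
move=> fL gL; have := Lfun2_comb 1 fL gL.
by under eq_fun do rewrite mul1r.
Qed.

Lemma Lfun2B f g : f \in L -> g \in L -> f \- g \in L.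
Proof.
move=> fL gL; have := Lfun2_comb (-1) gL fL.
by under eq_fun do rewrite mulN1r addrC.
Qed.

Lemma integrable_mul f g : f \in L -> g \in L ->
  mu.-integrable [set: T] (EFin \o (fun x => f x * g x)).
Proof. by move=> fL gL; apply/Lfun1_integrable; exact: Lfun2_mul_Lfun1. Qed.

Definition inner f g : R := \int[mu]_x (f x * g x).

Lemma innerC f g : inner f g = inner g f.
Proof. by apply: eq_Rintegral => x _; rewrite mulrC. Qed.

Lemma inner_combl c f g h : f \in L -> g \in L -> h \in L ->
  inner (fun x => c * f x + g x) h = c * inner f h + inner g h.
Proof.
move=> fL gL hL; rewrite /inner -RintegralZl//; last exact: integrable_mul.
rewrite -RintegralD//.
- by apply: eq_Rintegral => x _; rewrite mulrDl mulrA.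
- have := integrable_mul (Lfun2_scale c fL) hL.
  by apply: eq_integrable => // x _; rewrite /= mulrA.
- exact: integrable_mul.
Qed.

Lemma inner_combr c f g h : f \in L -> g \in L -> h \in L ->
  inner h (fun x => c * f x + g x) = c * inner h f + inner h g.
Proof. by move=> fL gL hL; rewrite innerC inner_combl// !(innerC h). Qed.

Lemma inner_scalel c f h : f \in L -> h \in L ->
  inner (fun x => c * f x) h = c * inner f h.
Proof.
move=> fL hL; rewrite /inner -RintegralZl//; last exact: integrable_mul.
by apply: eq_Rintegral => x _; rewrite mulrA.
Qed.

Lemma innerDl f g h : f \in L -> g \in L -> h \in L ->
  inner (f \+ g) h = inner f h + inner g h.
Proof.
move=> fL gL hL; rewrite -[inner f h]mul1r -inner_combl//.
by congr inner; apply/funext => x; rewrite mul1r.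
Qed.

Lemma innerBl f g h : f \in L -> g \in L -> h \in L ->
  inner (f \- g) h = inner f h - inner g h.
Proof.
move=> fL gL hL; rewrite addrC -mulN1r -inner_combl//.
by congr inner; apply/funext => x; rewrite mulN1r addrC.
Qed.

Lemma innerDr f g h : f \in L -> g \in L -> h \in L ->
  inner h (f \+ g) = inner h f + inner h g.
Proof. by move=> *; rewrite innerC innerDl// !(innerC h). Qed.

Lemma innerBr f g h : f \in L -> g \in L -> h \in L ->
  inner h (f \- g) = inner h f - inner h g.
Proof. by move=> *; rewrite innerC innerBl// !(innerC h). Qed.

Lemma inner_ge0 f : 0 <= inner f f.
Proof. by apply: Rintegral_ge0 => x _; rewrite -expr2 sqr_ge0. Qed.

(** The polynomial t -> <t f + g, t f + g> is nonnegative; its value at the minimizer gives the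
    claim. If <f, f> = 0 it is affine in t, and if <f, g> were nonzero the chosen t would give it
    the value -1. *)
Lemma inner_sqr_le f g : f \in L -> g \in L ->
  inner f g ^+ 2 <= inner f f * inner g g.
Proof.
move=> fL gL.
have H t : 0 <= t ^+ 2 * inner f f + 2 * t * inner f g + inner g g.
  have := inner_ge0 (fun x => t * f x + g x).
  rewrite inner_combl// ?Lfun2_comb// !inner_combr// (innerC g f).
  by move=> h0; apply: le_trans h0 _; rewrite le_eqVlt; apply/orP; left; apply/eqP; ring.
have [f0|f0] := eqVneq (inner f f) 0.
  have [->|fg0] := eqVneq (inner f g) 0; first by rewrite expr2 f0 !mul0r.
  have := H (- (inner g g + 1) / (2 * inner f g)).
  rewrite f0 mulr0 add0r.
  have -> : 2 * (- (inner g g + 1) / (2 * inner f g)) * inner f g = - (inner g g + 1).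
    by field.
  by lra.
have fp : 0 < inner f f by rewrite lt_def f0 inner_ge0.
have := H (- inner f g / inner f f).
have -> : (- inner f g / inner f f) ^+ 2 * inner f f +
    2 * (- inner f g / inner f f) * inner f g + inner g g =
  (inner f f * inner g g - inner f g ^+ 2) / inner f f by field.
by rewrite pmulr_lge0 ?invr_gt0// subr_ge0.
Qed.

Definition norm2 f : R := Num.sqrt (inner f f).

Lemma norm2_ge0 f : 0 <= norm2 f. Proof. exact: sqrtr_ge0. Qed.

Lemma sqr_norm2 f : norm2 f ^+ 2 = inner f f.
Proof. by rewrite sqr_sqrtr// inner_ge0. Qed.

Lemma inner_le f g : f \in L -> g \in L -> `|inner f g| <= norm2 f * norm2 g.
Proof.
move=> fL gL; rewrite -(@ler_pXn2r _ 2) ?nnegrE ?normr_ge0 ?mulr_ge0 ?norm2_ge0//.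
by rewrite exprMn !sqr_norm2 real_normK ?num_real// inner_sqr_le.
Qed.

Lemma norm2D f g : f \in L -> g \in L -> norm2 (f \+ g) <= norm2 f + norm2 g.
Proof.
move=> fL gL; rewrite -(@ler_pXn2r _ 2) ?nnegrE ?addr_ge0 ?norm2_ge0//.
rewrite sqr_norm2 innerDl ?Lfun2D// !innerDr// sqrrD !sqr_norm2 (innerC g f).
have := inner_le fL gL; have := ler_norm (inner f g).
by lra.
Qed.

Lemma norm2Z c f : f \in L -> norm2 (fun x => c * f x) = `|c| * norm2 f.
Proof.
move=> fL; rewrite /norm2 inner_scalel ?Lfun2_scale// innerC inner_scalel//.
by rewrite mulrA -expr2 sqrtrM ?sqr_ge0// sqrtr_sqr.
Qed.

Lemma norm2N f : f \in L -> norm2 (\- f) = norm2 f.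
Proof.
move=> fL; rewrite -[RHS]mul1r -normrN1 -norm2Z//.
by congr norm2; apply/funext => x; rewrite mulN1r.
Qed.

Lemma Lfun2N f : f \in L -> \- f \in L.
Proof.
by move=> /(Lfun2_scale (-1)); under eq_fun do rewrite mulN1r.
Qed.

Lemma norm2BC f g : f \in L -> g \in L -> norm2 (f \- g) = norm2 (g \- f).
Proof.
move=> fL gL; rewrite -norm2N ?Lfun2B//.
by congr norm2; apply/funext => x /=; rewrite opprB.
Qed.

Lemma norm2_triangle g f h : f \in L -> g \in L -> h \in L ->
  norm2 (f \- h) <= norm2 (f \- g) + norm2 (g \- h).
Proof.
move=> fL gL hL; apply: le_trans (norm2D _ _); rewrite ?Lfun2B//.
rewrite le_eqVlt; apply/orP; left; apply/eqP; congr norm2.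
by apply/funext => x /=; rewrite addrA subrK.
Qed.

Lemma EFin_inner f : f \in L ->
  (inner f f)%:E = (\int[mu]_x (f x ^+ 2)%:E)%E.
Proof.
move=> fL; rewrite /inner /Rintegral fineK.
  by apply: eq_integral => x _; rewrite expr2.
have := integrable_fin_num measurableT (integrable_mul fL fL).
by [].
Qed.

Lemma fine_Lnorm2 f : f \in L -> fine ('N[mu]_(2%:E) [EFin \o f])%E = norm2 f.
Proof.
move=> fL; rewrite unlock /Lnorm /norm2.
rewrite (_ : (\int[mu]_x _)%E = (inner f f)%:E); last first.
  rewrite EFin_inner//; apply: eq_integral => x _ /=.
  by rewrite powR_mulrn// real_normK ?num_real.
by rewrite poweR_EFin/= powR12_sqrt// inner_ge0.
Qed.

Lemma ae_eq_inner f g h : f \in L -> g \in L -> h \in L ->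
  f = g %[ae mu] -> inner f h = inner g h.
Proof.
move=> fL gL hL fg; rewrite /inner /Rintegral; congr fine.
have mf := Lfun2_measurable fL; have mg := Lfun2_measurable gL.
have mh := Lfun2_measurable hL.
apply: ae_eq_integral => //.
- by apply/measurable_EFinP; exact: measurable_funM.
- by apply/measurable_EFinP; exact: measurable_funM.
- by apply: filterS fg => x /(_ I) /= ->.
Qed.

Lemma ae_eq_norm2 f g : f \in L -> g \in L -> f = g %[ae mu] ->
  norm2 f = norm2 g.
Proof.
move=> fL gL fg; rewrite /norm2 (ae_eq_inner fL gL fL fg) innerC.
by rewrite (ae_eq_inner fL gL gL fg).
Qed.

Lemma norm2_eq0 f : f \in L -> norm2 f = 0 -> f = (fun=> 0) %[ae mu].
Proof.
move=> fL f0.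
have := Lfun2_measurable fL => mf.
have : ('N[mu]_(2%:E) [EFin \o f] = 0)%E.
  have := fine_Lnorm2 fL; rewrite f0 => /eqP.
  rewrite fine_eq0; first by move/eqP.
  move: fL; rewrite inE => /andP[_]; rewrite inE/= /finite_norm => foo.
  by rewrite ge0_fin_numE// Lnorm_ge0.
move/Lnorm_eq0_eq0 => /(_ _ _).
have /measurable_EFinP mf' := mf.
move=> /(_ mf') H; have := H ltac:(by rewrite lte_fin).
by apply: filterS => x /(_ I) [].
Qed.

Lemma Lfun2_mul m f (M : R) : measurable_fun [set: T] m -> (forall x, `|m x| <= M) ->
  f \in L -> (fun x => m x * f x) \in L.
Proof.
move=> mm mM fL; apply/Lfun2P; have mf := Lfun2_measurable fL.
split; first exact: measurable_funM.
apply: (@le_lt_trans _ _ (\int[mu]_x ((M ^+ 2 * (f x ^+ 2))%:E))%E).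
  apply: ge0_le_integral => //.
  - by move=> x _; rewrite lee_fin sqr_ge0.
  - by apply/measurable_EFinP/measurable_funX/measurable_funM.
  - apply/measurable_EFinP; apply: measurable_funM => //.
    exact: measurable_funX.
  - move=> x _; rewrite lee_fin exprMn ler_wpM2r ?sqr_ge0//.
    by rewrite -(real_normK (num_real (m x))) lerXn2r ?nnegrE// (le_trans _ (mM x)).
have /Lfun2P[_] := Lfun2_scale M fL.
by under eq_integral do rewrite exprMn.
Qed.

Lemma norm2_mul m f (M : R) : measurable_fun [set: T] m -> (forall x, `|m x| <= M) ->
  f \in L -> norm2 (fun x => m x * f x) <= M * norm2 f.
Proof.
move=> mm mM fL; have mf := Lfun2_measurable fL.
have M0 : 0 <= M by apply: le_trans (mM point).
rewrite -[M]ger0_norm// -norm2Z//.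
have mfL := Lfun2_mul mm mM fL; have MfL := Lfun2_scale M fL.
rewrite -(@ler_pXn2r _ 2) ?nnegrE ?norm2_ge0// !sqr_norm2.
rewrite -lee_fin !EFin_inner//; apply: ge0_le_integral => //.
- by move=> x _; rewrite lee_fin sqr_ge0.
- by apply/measurable_EFinP/measurable_funX/measurable_funM.
- by apply/measurable_EFinP/measurable_funX/measurable_funM.
- move=> x _; rewrite lee_fin !exprMn ler_wpM2r ?sqr_ge0//.
  by rewrite -(real_normK (num_real (m x))) lerXn2r ?nnegrE// (le_trans _ (mM x)).
Qed.

Lemma Lfun2_ae_eq f g : measurable_fun [set: T] g -> f \in L ->
  f = g %[ae mu] -> g \in L.
Proof.
move=> mg /Lfun2P[mf foo] fg; apply/Lfun2P; split => //.
rewrite (@ge0_ae_eq_integral _ _ _ _ _ _ (fun x => (f x ^+ 2)%:E))//.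
- by apply/measurable_EFinP/measurable_funX.
- by apply/measurable_EFinP/measurable_funX.
- by move=> x _; rewrite lee_fin sqr_ge0.
- by move=> x _; rewrite lee_fin sqr_ge0.
- by apply: filterS fg => x /(_ I) /= ->.
Qed.

(** Fatou's lemma for the squares of f - h_k. In the completeness proof it puts the pointwise limit
    of a subsequence in L^2 and bounds its distance to the terms of the sequence. *)
Lemma norm2_fatou f (h : nat -> T -> R) g (e : R) :
  f \in L -> (forall k, h k \in L) -> (forall x, h k x @[k --> \oo] --> g x) ->
  0 <= e -> (forall k, norm2 (f \- h k) <= e) ->
  g \in L /\ norm2 (f \- g) <= e.
Proof.
move=> fL hL hg e0 he.
have mf := Lfun2_measurable fL; have mh k := Lfun2_measurable (hL k).
have mg : measurable_fun setT g by apply: measurable_fun_cvg mh _ => x _; exact: hg.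
have H : (\int[mu]_x (((f \- g) x) ^+ 2)%:E <= (e ^+ 2)%:E)%E.
  apply: (@le_trans _ _ (\int[mu]_x limn_einf (fun k => (((f \- h k) x) ^+ 2)%:E))%E).
    rewrite le_eqVlt; apply/orP; left; apply/eqP/eq_integral => x _.
    have : (((f \- h k) x) ^+ 2)%:E @[k --> \oo] --> (((f \- g) x) ^+ 2)%:E.
      apply: cvg_EFin; first exact: nearW.
      apply: (@cvg_comp _ _ _ (fun k => (f \- h k) x) (fun y : R => y ^+ 2) _
        (nbhs ((f \- g) x))); last exact: exprn_continuous.
      by apply: cvgB; [exact: cvg_cst|exact: hg].
    move=> /cvg_limn_einf_sup[] //.
  apply: (le_trans (fatou _ _ _ _)) => //.
  - by move=> k; apply/measurable_EFinP/measurable_funX/measurable_funB.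
  - by move=> k x _; rewrite lee_fin sqr_ge0.
  rewrite limn_einf_lim; apply: lime_le; first exact: is_cvg_einfs.
  apply: nearW => n; apply: (@le_trans _ _ (\int[mu]_x (((f \- h n) x) ^+ 2)%:E))%E.
    by apply: ereal_inf_lbound; exists n => /=.
  rewrite -EFin_inner ?Lfun2B// lee_fin -sqr_norm2.
  by rewrite lerXn2r ?nnegrE ?norm2_ge0.
have fgL : f \- g \in L.
  by apply/Lfun2P; split; [exact: measurable_funB|exact: le_lt_trans H (ltry _)].
split.
  have -> : g = f \- (f \- g).
    by apply/funext => x /=; rewrite opprB addrC subrK.
  exact: Lfun2B.
rewrite -(@ler_pXn2r _ 2) ?nnegrE ?norm2_ge0//.
by rewrite sqr_norm2 -lee_fin EFin_inner.
Qed.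

(* If the sum of 4^k |u_k|^2 converges then |u_k| is dominated by a geometric
   sequence of ratio 1/2. *)
Lemma weighted_sqr_cvg_series (u : nat -> R) :
  (\sum_(k <oo) (4 ^+ k * u k ^+ 2)%:E < +oo)%E -> cvgn (series u).
Proof.
move=> uoo.
have [C C0 uC] : exists2 C : R, 0 <= C & forall k, `|u k| <= C * 2^-1 ^+ k.
  have t0 k : (0 <= (4 ^+ k * u k ^+ 2)%:E :> \bar R)%E.
    by rewrite lee_fin mulr_ge0 ?sqr_ge0// exprn_ge0.
  set S : \bar R := (\sum_(k <oo) _)%E in uoo.
  have S0 : (0 <= S)%E by apply: nneseries_ge0 => k _ _; exact: t0.
  have Sf : S \is a fin_num by rewrite ge0_fin_numE.
  exists (Num.sqrt (fine S)) => [|k]; first exact: sqrtr_ge0.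
  rewrite -(@ler_pXn2r _ 2) ?nnegrE ?mulr_ge0 ?exprn_ge0 ?sqrtr_ge0//.
  rewrite exprMn sqr_sqrtr ?fine_ge0// -exprM mulnC exprM.
  have -> : (2^-1 ^+ 2 : R) = 4^-1 by field.
  rewrite exprVn real_normK ?num_real// ler_pdivlMr ?exprn_gt0// mulrC.
  rewrite -lee_fin fineK//.
  apply: le_trans (nneseries_lim_ge k.+1 _).
    by rewrite big_nat_recr//= leeDr// sume_ge0.
  by move=> n _ _; exact: t0.
apply: normed_cvg; apply: (@series_le_cvg _ _ (geometric C 2^-1)) => [k|k|k|].
- exact: normr_ge0.
- by rewrite /= mulr_ge0// exprn_ge0.
- exact: uC.
- by apply: is_cvg_geometric_series; rewrite ger0_norm//; lra.
Qed.

(** Riesz-Fischer, with rate 4^-k along a subsequence: the weighted squares 4^k D_k^2 have integral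
    at most 4^-k, so their sum [W] is integrable, hence finite a.e., and where it is finite the
    telescoping series of the D_k converges. *)
Lemma norm2_complete (f : nat -> T -> R) : (forall n, f n \in L) ->
  (forall e : R, 0 < e -> exists N, forall n k, (N <= n)%N -> (N <= k)%N ->
     norm2 (f n \- f k) <= e) ->
  exists2 g, g \in L &
    forall e : R, 0 < e -> exists N, forall n, (N <= n)%N -> norm2 (f n \- g) <= e.
Proof.
move=> fL fC.
have [p Hp] : {p : nat -> nat & forall k n l, (p k <= n)%N -> (p k <= l)%N ->
    norm2 (f n \- f l) <= 4^-1 ^+ k}.
  apply: (@choice _ _ (fun k N => forall n l, (N <= n)%N -> (N <= l)%N ->
    norm2 (f n \- f l) <= 4^-1 ^+ k)) => k.
  by apply: fC; rewrite exprn_gt0// invr_gt0.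
(* Summing the successors makes [q] nondecreasing, with [q k] at least [p k] and at least [k]. *)
pose q k := (\sum_(j < k.+1) (p j).+1)%N.
have qS k : (q k <= q k.+1)%N by rewrite /q [X in (_ <= X)%N]big_ord_recr/= leq_addr.
have pq k : (p k <= q k)%N.
  by rewrite /q big_ord_recr/= (leq_trans (leqnSn _))// leq_addl.
have kq k : (k <= q k)%N.
  rewrite /q (@leq_trans (\sum_(j < k.+1) 1)%N) ?leq_sum//.
  by rewrite sum1_card card_ord.
pose D k := f (q k.+1) \- f (q k).
have DL k : D k \in L by exact: Lfun2B.
have mD k := Lfun2_measurable (DL k).
pose F k x := (4 ^+ k * D k x ^+ 2)%:E : \bar R.
have F0 k x : (0 <= F k x)%E by rewrite lee_fin mulr_ge0 ?sqr_ge0// exprn_ge0.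
have mF k : measurable_fun setT (F k).
  by apply/measurable_EFinP/measurable_funM => //; exact: measurable_funX.
pose W x := (\sum_(k <oo) F k x)%E.
have mW : measurable_fun setT W.
  exact: (@ge0_emeasurable_sum _ _ _ _ F xpredT).
have W0 x : (0 <= W x)%E by exact: nneseries_ge0.
have Woo : (\int[mu]_x W x < +oo)%E.
  rewrite integral_nneseries//.
  apply: (@le_lt_trans _ _ (\sum_(k <oo) (geometric 1 4^-1 k)%:E)%E).
    apply: lee_nneseries => [k _ _|k _]; first exact: integral_ge0.
    rewrite /F; under eq_integral do rewrite EFinM.
    rewrite ge0_integralZl_EFin//; last 2 first.
      by move=> x _; rewrite lee_fin sqr_ge0.
      by apply/measurable_EFinP/measurable_funX.
    rewrite -EFin_inner// -EFinM lee_fin -sqr_norm2.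
    have : norm2 (D k) <= 4^-1 ^+ k.
      by apply: Hp; rewrite ?pq// (leq_trans (pq k)).
    have /= := @ler_pXn2r R 2 isT (norm2 (D k)) (4^-1 ^+ k).
    rewrite !nnegrE norm2_ge0 exprn_ge0// => /(_ isT isT) <- H.
    rewrite mul1r; apply: le_trans (ler_wpM2l _ H) _; first exact: exprn_ge0.
    by rewrite expr2 mulrA -exprMn divff ?pnatr_eq0// expr1n mul1r.
  have : cvgn (series (geometric (1 : R) 4^-1)).
    by apply: is_cvg_geometric_series; rewrite ger0_norm//; lra.
  move=> /cvg_ex[l Hl]; rewrite (_ : (\sum_(k <oo) _)%E = l%:E) ?ltry//.
  apply/cvg_lim => //.
  under eq_fun do rewrite sumEFin.
  apply: cvg_EFin; first exact: nearW.
  exact: Hl.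
pose A := [set x | W x \is a fin_num].
have mA : measurable A.
  rewrite -[A]setTI.
  exact: emeasurable_fin_num measurableT mW.
have aeA : {ae mu, forall x, A x}.
  have : mu.-integrable setT W.
    apply/integrableP; split => //.
    by under eq_integral do rewrite gee0_abs//.
  move=> /integrable_ae => /(_ measurableT); apply: filterS => x; exact.
(* Cutting off outside [A] makes the subsequence converge everywhere and not only almost everywhere,
   as [norm2_fatou] requires. *)
pose h k x := f (q k) x * \1_A x.
have fh k : f (q k) = h k %[ae mu].
  apply: filterS aeA => x Ax _; rewrite /h indicE mem_set// mulr1//.
have hL k : h k \in L.
  apply: Lfun2_ae_eq (fL (q k)) (fh k).
  by apply: measurable_funM; [exact: Lfun2_measurable|exact: measurable_indic].
have hcvg x : cvgn (h ^~ x).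
  rewrite /h; have [Ax|nAx] := pselect (A x); last first.
    rewrite (_ : (fun k => _) = cst 0); first exact: is_cvg_cst.
    by apply/funext => k; rewrite indicE memNset// mulr0.
  rewrite indicE mem_set//=.
  have DA : cvgn (series (D ^~ x)).
    by apply: weighted_sqr_cvg_series; move: Ax; rewrite /A/= ge0_fin_numE.
  rewrite (_ : (fun k => _) = (fun k => f (q 0%N) x + series (D ^~ x) k)).
    by apply: is_cvgD => //; exact: is_cvg_cst.
  apply/funext => k; rewrite mulr1 seriesEnat/= telescope_sumr// addrC subrK//.
pose g x := limn (h ^~ x).
have hg x : h k x @[k --> \oo] --> g x by exact: hcvg.
have key e : 0 < e -> exists N, forall n, (N <= n)%N -> g \in L /\ norm2 (f n \- g) <= e.
  move=> e0; have [N HN] := fC _ e0; exists N => n Nn.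
  apply: (@norm2_fatou (f n) (fun k => h (k + N)%N) g e) => //.
  - by move=> x; have := hg x; rewrite -(cvg_shiftn N).
  - exact: ltW.
  - move=> k; rewrite (@ae_eq_norm2 _ (f n \- f (q (k + N)%N))) ?Lfun2B//.
      by apply: HN => //; rewrite (leq_trans _ (kq _))// leq_addl.
    by apply: filterS (fh (k + N)%N) => x H xT /=; rewrite H.
have [N HN] := key 1 ltr01; exists g; first by have [] := HN N (leqnn _).
move=> e e0; have [M HM] := key e e0; exists M => n /HM[]//.
Qed.

End square_integrable.

(** * Lebesgue measure on R^d and the Poincare inequality *)

Section boxes.
Context (R : realType) (d : nat).
Implicit Types (x a b : 'rV[R]_d) (A : set 'rV[R]_d).

Definition box a b : set 'rV[R]_d :=
  [set x | forall i, a ord0 i < x ord0 i < b ord0 i].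

Definition cbox a b : set 'rV[R]_d :=
  [set x | forall i, a ord0 i <= x ord0 i <= b ord0 i].

Lemma rV_ballP x (e : R) y :
  ball x e y <-> 0 < e /\ forall i, `|x ord0 i - y ord0 i| < e.
Proof.
split=> [[e0 H]|[e0 H]]; first by split=> // i; exact: H.
by split=> // i j; rewrite (ord1 i); exact: H.
Qed.

Lemma ler_coord_norm x i : `|x ord0 i| <= `|x|.
Proof.
rewrite [leRHS]/Num.norm /= mx_normrE; apply/bigmax_geP; right => /=.
by exists (ord0, i).
Qed.

Lemma box_open a b : open (box a b).
Proof.
rewrite openE => x xab; rewrite /interior.
have : \forall y \near x, forall i : 'I_d, a ord0 i < (y : 'rV[R]_d) ord0 i < b ord0 i.
  apply: (@filter_forall _ _ (fun i (y : 'rV[R]_d) => a ord0 i < y ord0 i < b ord0 i)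
    (nbhs (x : 'rV[R]_d))) => i.
  have /open_nbhs_nbhs : open_nbhs (x ord0 i) `]a ord0 i, b ord0 i[%classic.
    by split; [exact: interval_open|rewrite /= in_itv/=; exact: xab].
  move=> /(@coord_continuous R 1 d ord0 i x).
  by apply: (@filterS _ (nbhs (x : 'rV[R]_d))) => y; rewrite /= in_itv.
by [].
Qed.

(** The inclusion concerns the closed box: it will contain the support of a bump, and its lower
    corner is a rational point of [A]. *)
Lemma nbhs_rat_box x A : nbhs x A ->
  exists q : 'rV[rat]_d * 'rV[rat]_d,
    box (map_mx ratr q.1) (map_mx ratr q.2) x /\
    cbox (map_mx ratr q.1) (map_mx ratr q.2) `<=` A.
Proof.
move=> /nbhs_ballP[e /= e0 eA].
have [l Hl] : {l : 'I_d -> rat & forall i, x ord0 i - e < ratr (l i) < x ord0 i}.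
  apply: (@boolp.choice _ _ (fun i q => x ord0 i - e < ratr q < x ord0 i)) => i.
  have [q] := @rat_in_itvoo R (x ord0 i - e) (x ord0 i) ltac:(by rewrite ltrBlDr ltrDl).
  by rewrite in_itv/=; exists q.
have [r Hr] : {r : 'I_d -> rat & forall i, x ord0 i < ratr (r i) < x ord0 i + e}.
  apply: (@boolp.choice _ _ (fun i q => x ord0 i < ratr q < x ord0 i + e)) => i.
  have [q] := @rat_in_itvoo R (x ord0 i) (x ord0 i + e) ltac:(by rewrite ltrDl).
  by rewrite in_itv/=; exists q.
exists (\row_i l i, \row_i r i); split=> [i|y H].
  by rewrite /= !mxE; have /andP[_ ->] := Hl i; have /andP[-> _] := Hr i.
apply: eA; apply/rV_ballP; split=> // i.
have := H i; rewrite /= !mxE => /andP[].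
have /andP[] := Hl i; have /andP[] := Hr i.
by rewrite ltr_norml; lra.
Qed.

Lemma box_measurable a b : measurable (box a b).
Proof.
rewrite (_ : box a b = \bigcap_(i in [set: 'I_d])
    ((fun x : 'rV[R]_d => x ord0 i) @^-1` `]a ord0 i, b ord0 i[%classic)).
  apply: fin_bigcap_measurable => // i _.
  by rewrite -[X in measurable X]setTI; exact: measurable_coord.
by apply/seteqP; split => x H i; [move=> _|]; have := H i; rewrite /= in_itv//=; apply.
Qed.

Lemma open_rat_boxes A : open A ->
  A = \bigcup_(q in [set q : 'rV[rat]_d * 'rV[rat]_d |
        cbox (map_mx ratr q.1) (map_mx ratr q.2) `<=` A])
      box (map_mx ratr q.1) (map_mx ratr q.2).
Proof.
move=> oA; apply/seteqP; split=> [x Ax|x [q qA xq]].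
  by have [q [xq qA]] := nbhs_rat_box (open_nbhs_nbhs (conj oA Ax)); exists q.
by apply: qA => i; have /andP[/ltW -> /ltW ->] := xq i.
Qed.

(** By second countability, the sigma-algebra generated by the coordinates contains the open
    sets. *)
Lemma open_measurable_rV A : open A -> measurable A.
Proof.
move=> /open_rat_boxes ->; rewrite bigcup_mkcond.
apply: countable_bigcupT_measurable => [|q]; first exact: countableP.
by case: ifPn => _; [exact: box_measurable|exact: measurable0].
Qed.

Lemma continuous_measurable_rV (D : set 'rV[R]_d) (f : 'rV[R]_d -> R) :
  open D -> (forall x, D x -> {for x, continuous f}) -> measurable_fun D f.
Proof.
move=> oD cf; apply: (measurability _ (RGenOInfty.measurableE R)).
move=> _ [_ [r ->] <-]; apply: open_measurable_rV.
rewrite openE => x [Dx /= xr].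
apply: filterI; first exact: open_nbhs_nbhs.
by apply: cf => //; apply: open_nbhs_nbhs; split => //; exact: interval_open.
Qed.

End boxes.

(** * Tonelli's theorem on R^d and the Poincare inequality in the first coordinate *)

Lemma cbox_measurable (R : realType) (d : nat) (a b : 'rV[R]_d) :
  measurable (cbox a b).
Proof.
rewrite (_ : cbox a b = \bigcap_(i in [set: 'I_d])
    ((fun x : 'rV[R]_d => x ord0 i) @^-1` `[a ord0 i, b ord0 i]%classic)).
  apply: fin_bigcap_measurable => // i _.
  by rewrite -[X in measurable X]setTI; exact: measurable_coord.
by apply/seteqP; split => x H i; [move=> _|]; have := H i; rewrite /= in_itv//=; apply.
Qed.

Lemma rV_cons0 (R : realType) d (t : R) (y : 'rV[R]_d) :
  rV_cons (t, y) ord0 ord0 = t.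
Proof.
rewrite /rV_cons /= (_ : ord0 = lshift d (ord0 : 'I_1)); last exact: val_inj.
by rewrite (row_mxEl (const_mx _ : 'rV_1)) mxE.
Qed.

Lemma rV_consS (R : realType) d (t : R) (y : 'rV[R]_d) i :
  rV_cons (t, y) ord0 (lift ord0 i) = y ord0 i.
Proof.
rewrite /rV_cons /= (_ : lift ord0 i = rshift 1 i); last exact: val_inj.
by rewrite (row_mxEr (const_mx _ : 'rV_1)).
Qed.

Lemma lebesgue_rV_cbox (R : realType) (d : nat) (r : R) :
  (lebesgue_rV R d (cbox (const_mx (- r)%R) (const_mx r%R)) < +oo)%E.
Proof.
elim: d => [|d IHd] /=; first by rewrite diracE; case: (_ \in _) => //=; rewrite ltry.
rewrite /lebesgue_step /pushforward.
set A := _ @^-1` _; have -> : A = `[- r, r]%classic `*` cbox (const_mx (- r)) (const_mx r).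
  apply/seteqP; split=> [[t y] H|[t y] [/= H1 H2] i] /=.
    split=> [|i].
      by have := H ord0; rewrite rV_cons0 !mxE in_itv.
    by have := H (lift ord0 i); rewrite rV_consS !mxE.
  have [->|[j ->]] : i = ord0 \/ exists j, i = lift ord0 j.
  - by case: (unliftP ord0 i) => [j ->|->]; [right; exists j|left].
  - by rewrite rV_cons0 !mxE; move: H1; rewrite in_itv.
  - by rewrite rV_consS; have := H2 j; rewrite !mxE.
rewrite product_measure2E//; last exact: cbox_measurable.
rewrite lte_mul_pinfty//=.
  by rewrite lebesgue_measure_itv/=; case: ifPn; rewrite // -EFinB.
Qed.

(** A named set function to which the sigma-finite structure demanded by Tonelli's theorem can be
    attached. *)
Definition lebesgue_rV_fun (R : realType) (d : nat) : set 'rV[R]_d -> \bar R :=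
  lebesgue_rV R d.

HB.instance Definition _ (R : realType) (d : nat) :=
  Measure.on (@lebesgue_rV_fun R d).

Lemma bigcup_cbox (R : realType) (d : nat) :
  \bigcup_n cbox (const_mx (- n%:R)) (const_mx n%:R) = [set: 'rV[R]_d].
Proof.
apply/seteqP; split=> // x _.
exists (Num.bound `|x|) => // i; rewrite !mxE -ler_norml.
by rewrite (le_trans (ler_coord_norm x i))// ltW// -[X in X < _]normr_id unstable.ltr_norm_bound//.
Qed.

Lemma lebesgue_rV_sigma_finite (R : realType) (d : nat) :
  sigma_finite [set: 'rV[R]_d] (@lebesgue_rV_fun R d).
Proof.
exists (fun n => cbox (const_mx (- n%:R)) (const_mx n%:R)).
  by rewrite bigcup_cbox.
by move=> n; split; [exact: cbox_measurable|exact: lebesgue_rV_cbox].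
Qed.

HB.instance Definition _ (R : realType) (d : nat) :=
  Measure_isSigmaFinite.Build _ _ _ (@lebesgue_rV_fun R d)
    (@lebesgue_rV_sigma_finite R d).

Local Open Scope ereal_scope.

Lemma ge0_integral_lebesgue_rVS (R : realType) (d : nat) (f : 'rV[R]_d.+1 -> \bar R) :
  measurable_fun setT f -> (forall x, 0 <= f x) ->
  \int[lebesgue_rV R d.+1]_x f x =
  \int[lebesgue_rV R d]_y \int[lebesgue_measure]_t f (rV_cons (t, y)).
Proof.
move=> mf f0 /=.
rewrite ge0_integral_pushforward//; last exact: measurable_rV_cons.
rewrite preimage_setT.
pose m1 : {sigma_finite_measure set (measurableTypeR R) -> \bar R} := lebesgue_measure.
(* The recursive definition uses the product [\x^], Tonelli's theorem is applied to [\x]; uniqueness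
   of product measures identifies the two. *)
have E : forall A, measurable A ->
    (m1 \x^ (lebesgue_rV R d)) A = (m1 \x @lebesgue_rV_fun R d) A.
  move=> A mA; apply/esym/(product_measure_unique (m1 := m1) (m2 := @lebesgue_rV_fun R d)) =>
    // A1 A2 mA1 mA2.
  by rewrite [LHS](product_measure2E m1 (lebesgue_rV R d)).
rewrite (eq_measure_integral (m1 \x @lebesgue_rV_fun R d)); last by move=> A mA _; exact: E.
rewrite fubini_tonelli2//=.
by apply: measurableT_comp => //; exact: measurable_rV_cons.
Qed.

Local Close Scope ereal_scope.

Lemma rV_cons_shift (R : realType) d (h t : R) (y : 'rV[R]_d) :
  rV_cons (h + t, y) = h *: delta_mx ord0 ord0 + rV_cons (t, y).
Proof.
have E i : (h *: delta_mx ord0 ord0 + rV_cons (t, y)) ord0 i =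
    h * (i == ord0)%:R + rV_cons (t, y) ord0 i.
  by rewrite [LHS]mxE; congr (_ + _); rewrite !mxE.
apply/rowP => i; rewrite E.
case: (unliftP ord0 i) => [j ->|->]; first by rewrite !rV_consS mulr0 add0r.
by rewrite !rV_cons0 eqxx mulr1.
Qed.

Lemma continuous_rV_cons (R : realType) d (y : 'rV[R]_d) :
  continuous (fun t : R => rV_cons (t, y)).
Proof.
have -> : (fun t : R => rV_cons (t, y)) =
    (fun t => t *: delta_mx ord0 ord0 + rV_cons (0, y)).
  by apply/funext => t; rewrite -rV_cons_shift addr0.
by move=> t; apply: cvgD; [apply: cvgZr_tmp; exact: cvg_id|exact: cvg_cst].
Qed.

(* With [F t = t * g t ^ 2] one has [g ^ 2 <= 2 F' + 4 M ^ 2 g' ^ 2] for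
   [`|t| <= M], and [F] vanishes at both ends of [-M, M]. *)
Lemma poincare_1d (R : realType) (g g' : R -> R) (M : R) : 0 < M ->
  continuous g -> continuous g' -> (forall t : R, is_derive t (1 : R) g (g' t)) ->
  (forall t, M <= `|t| -> g t = 0) ->
  (\int[lebesgue_measure]_t (g t ^+ 2)%:E <=
   (4 * M ^+ 2)%:E * \int[lebesgue_measure]_t (g' t ^+ 2)%:E)%E.
Proof.
move=> M0 cg cg' dg g0.
pose F (t : R) := t * g t ^+ 2; pose F' (t : R) := g t ^+ 2 + t * (2 * g t * g' t).
have MM : - M < M by lra.
pose I : set R := `[(- M), M]%classic.
have mI : measurable I by exact: measurable_itv.
have C0 : 0 <= 4 * M ^+ 2 by rewrite mulr_ge0// sqr_ge0.
have cF' : continuous F'.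
  move=> t; apply: cvgD; first by apply: cvgM; exact: cg.
  apply: cvgM; first exact: cvg_id.
  by apply: cvgM; [apply: cvgM; [exact: cvg_cst|exact: cg]|exact: cg'].
have dF t : is_derive (t : R) (1 : R) F (F' t).
  rewrite /F; apply: is_derive_eq.
  by rewrite /F' /GRing.scale /=; ring.
have cF : continuous F.
  by move=> t; apply: cvgM; [exact: cvg_id|apply: cvgM; exact: cg].
have F0 : (\int[lebesgue_measure]_(t in I) (F' t)%:E = 0)%E.
  rewrite (@continuous_FTC2 _ F' F (- M) M) //.
  - have -> : F M = 0 by rewrite /F g0 ?expr0n ?mulr0// ler_norm.
    have -> : F (- M) = 0 by rewrite /F g0 ?expr0n ?mulr0// normrN ler_norm.
    by rewrite subee.
  - exact: continuous_subspaceT.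
  - split; first by move=> t _; have [] := dF t.
    + exact/cvg_at_right_filter/cF.
    + exact/cvg_at_left_filter/cF.
  - by move=> t _; rewrite derive1E; have [_] := dF t.
have iC (h : R -> R) : continuous h ->
    lebesgue_measure.-integrable I (EFin \o h).
  move=> ch; apply: continuous_compact_integrable; first exact: segment_compact.
  exact: continuous_subspaceT.
have cg2 : continuous (fun t => g t ^+ 2) by move=> t; apply: cvgM; exact: cg.
have cg'2 : continuous (fun t => g' t ^+ 2) by move=> t; apply: cvgM; exact: cg'.
have -> : (\int[lebesgue_measure]_t (g t ^+ 2)%:E =
    \int[lebesgue_measure]_(t in I) (g t ^+ 2)%:E)%E.
  rewrite [RHS]integral_mkcond; apply: eq_integral => t _; rewrite patchE.
  case: ifPn => //; rewrite notin_setE /I /= in_itv/= => /negP; rewrite -ler_norml -ltNge.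
  by move=> /ltW /g0 ->; rewrite expr0n.
apply: (@le_trans _ _ (\int[lebesgue_measure]_(t in I)
    (2%:E * (F' t)%:E + (4 * M ^+ 2)%:E * (g' t ^+ 2)%:E))%E).
  apply: le_integral => //.
  - exact: iC.
  - apply: integrableD => //; apply: integrableZl => //; exact: iC.
  - move=> t tM.
    rewrite -!EFinM -EFinD lee_fin /F'.
    have {}tM : `|t| <= M by rewrite ler_norml; move: tM; rewrite inE /I /= in_itv.
    have tM2 : t ^+ 2 <= M ^+ 2.
      rewrite -(@real_normK _ t) ?num_real// lerXn2r ?nnegrE ?(ltW M0)//.
    (* The certificate is 2 F' + 4 M^2 g'^2 - g^2 = (g + 2 t g')^2 + 4 (M^2 - t^2) g'^2. *)
    have : 0 <= (M ^+ 2 - t ^+ 2) * g' t ^+ 2 by rewrite mulr_ge0 ?sqr_ge0 ?subr_ge0.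
    have : 0 <= (g t + 2 * t * g' t) ^+ 2 by rewrite sqr_ge0.
    by nra.
rewrite integralD//; last 2 first.
- by apply: integrableZl => //; exact: iC.
- by apply: integrableZl => //; exact: iC.
rewrite !integralZl//; [|exact: iC|exact: iC].
rewrite F0 mule0 add0e; apply: lee_wpmul2l.
  by rewrite lee_fin.
apply: ge0_subset_integral => //.
- by apply/measurable_EFinP; exact: continuous_measurable_fun.
- by move=> t _; rewrite lee_fin sqr_ge0.
Qed.


Lemma is_derive_slice (R : realType) d (phi : 'rV[R]_d.+1 -> R) (t : R)
    (y : 'rV[R]_d) : derivable phi (rV_cons (t, y)) (delta_mx ord0 ord0) ->
  is_derive t (1 : R) (fun t => phi (rV_cons (t, y)))
    (partial ord0 phi (rV_cons (t, y))).
Proof.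
have E : (fun h : R => h^-1 *: (((fun t => phi (rV_cons (t, y))) \o shift t) (h *: (1 : R))
      - phi (rV_cons (t, y)))) =
    (fun h : R => h^-1 *: ((phi \o shift (rV_cons (t, y))) (h *: delta_mx ord0 ord0)
      - phi (rV_cons (t, y)))).
  by apply/funext => h /=; rewrite scaler1 -rV_cons_shift.
by move=> dphi; split; [rewrite /derivable E|rewrite /derive E].
Qed.

(** [poincare_1d] on every line parallel to the first axis, integrated over the remaining
    coordinates. *)
Lemma poincare_first_coord (R : realType) d (phi : 'rV[R]_d.+1 -> R) (M : R) :
  0 < M -> continuous phi -> continuous (partial ord0 phi) ->
  (forall x, derivable phi x (delta_mx ord0 ord0)) ->
  (forall x : 'rV[R]_d.+1, M <= `|x ord0 ord0| -> phi x = 0) ->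
  (\int[lebesgue_rV R d.+1]_x (phi x ^+ 2)%:E <=
   (4 * M ^+ 2)%:E * \int[lebesgue_rV R d.+1]_x (partial ord0 phi x ^+ 2)%:E)%E.
Proof.
move=> M0 cphi cdphi dphi phi0.
have m2 (g : 'rV[R]_d.+1 -> R) : continuous g ->
    measurable_fun setT (fun x => (g x ^+ 2)%:E).
  move=> cg; apply/measurable_EFinP/measurable_funX.
  by apply: continuous_measurable_rV => [|x _]; [exact: openT|exact: cg].
have mS (g : 'rV[R]_d.+1 -> R) : continuous g ->
    measurable_fun setT (fun y => \int[lebesgue_measure]_t (g (rV_cons (t, y)) ^+ 2)%:E)%E.
  move=> cg; pose m1 : {sigma_finite_measure set (measurableTypeR R) -> \bar R} := lebesgue_measure.
  apply: (@measurable_fun_fubini_tonelli_G _ _ _ _ _ m1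
    (fun p => (g (rV_cons p) ^+ 2)%:E)) => [|p]; last by rewrite lee_fin sqr_ge0.
  have := measurableT_comp (m2 _ cg) (@measurable_rV_cons R d).
  by [].
rewrite !ge0_integral_lebesgue_rVS//; last 4 first.
- exact: m2.
- by move=> x; rewrite lee_fin sqr_ge0.
- exact: m2.
- by move=> x; rewrite lee_fin sqr_ge0.
rewrite -ge0_integralZl//; last 3 first.
- exact: mS.
- by move=> y _; apply: integral_ge0 => t _; rewrite lee_fin sqr_ge0.
- by rewrite lee_fin mulr_ge0// sqr_ge0.
apply: ge0_le_integral => //.
- by move=> y _; apply: integral_ge0 => t _; rewrite lee_fin sqr_ge0.
- exact: mS.
- by apply: measurable_funeM; exact: mS.
move=> y _; apply: (@poincare_1d R (fun t => phi (rV_cons (t, y)))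
  (fun t => partial ord0 phi (rV_cons (t, y)))) => //.
- by move=> t; apply: continuous_comp; [exact: continuous_rV_cons|exact: cphi].
- by move=> t; apply: continuous_comp; [exact: continuous_rV_cons|exact: cdphi].
- by move=> t; apply: is_derive_slice; exact: dphi.
- by move=> t Mt; apply: phi0; rewrite rV_cons0.
Qed.

Lemma polyhedral_open (R : realType) (d : nat) (D : set 'rV[R]_d) :
  convex_polyhedral_domain D -> open D.
Proof.
move=> [_ _ [m [N [b ->]]]]; rewrite openE => x xD.
have H : \forall y \near x, forall i, (N *m (y : 'rV[R]_d)^T) i ord0 < b i ord0.
  apply: (@filter_forall _ _ (fun i (y : 'rV[R]_d) => (N *m y^T) i ord0 < b i ord0)
    (nbhs (x : 'rV[R]_d))) => i.
  have c : continuous (fun y : 'rV[R]_d => (N *m y^T) i ord0).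
    have -> : (fun y : 'rV[R]_d => (N *m y^T) i ord0) =
        (fun y => \sum_j N i j * y ord0 j).
      by apply/funext => y; rewrite mxE; apply: eq_bigr => j _; rewrite mxE.
    apply: (@continuous_big _ _ _ _ _ _ 'rV[R]_d) => [|j _ y].
      exact: (@add_continuous R^o).
    exact: (continuous_comp (@coord_continuous R 1 d ord0 j y) (@mulrl_continuous R (N i j) _)).
  have /open_nbhs_nbhs : open_nbhs ((N *m x^T) i ord0) `]-oo, b i ord0[%classic.
    by split; [exact: interval_open|rewrite /= in_itv/=; exact: xD].
  by move=> /(c x); apply: (@filterS _ (nbhs (x : 'rV[R]_d))) => y; rewrite /= in_itv.
by [].
Qed.

Lemma bounded_set_cbox (R : realType) (d : nat) (D : set 'rV[R]_d) :
  bounded_set D -> exists2 M : R, 0 < M & D `<=` cbox (const_mx (- M)) (const_mx M).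
Proof.
move=> [M [_ HM]]; exists (`|M| + 1); first by rewrite ltr_wpDl.
move=> x Dx i; rewrite !mxE -ler_norml (le_trans (ler_coord_norm x i))//.
apply: (HM (`|M| + 1)) => //.
by rewrite (le_lt_trans (ler_norm M))// ltrDl.
Qed.

(** * Restriction of the Lebesgue measure to D *)

Section lebesgue_on_domain.
Context (R : realType) (d : nat) (D : set 'rV[R]_d).
Hypothesis hD : convex_polyhedral_domain D.
Local Notation mu := (lebesgue_rV R d).
Local Notation nu := (lebesgue_on hD).

Let mD : measurable D. Proof. exact: measurable_polyhedral_domain. Qed.

Lemma lebesgue_on_setT : (nu [set: 'rV[R]_d] < +oo)%E.
Proof.
rewrite /lebesgue_on /mrestr setTI.
have [_ /bounded_set_cbox[M _ DM] _] := hD.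
apply: le_lt_trans (lebesgue_rV_cbox d M).
by apply: le_measure; rewrite ?inE//; exact: cbox_measurable.
Qed.

Lemma lebesgue_onC : nu (~` D) = 0%E.
Proof. by rewrite /lebesgue_on /mrestr setICl measure0. Qed.

Lemma ae_lebesgue_on : {ae nu, forall x, D x}.
Proof. by exists (~` D); split; [exact: measurableC|exact: lebesgue_onC|]. Qed.

(** The weak formulations integrate over D against [mu], whereas the L^2 calculus works on the whole
    space with [nu], which vanishes off D; this is the passage between them. *)
Lemma integral_lebesgue_on (f : 'rV[R]_d -> \bar R) :
  nu.-integrable setT f ->
  (\int[mu]_(x in D) f x = \int[nu]_x f x)%E.
Proof.
move=> fi; rewrite (negligible_integral _ _ _ lebesgue_onC)//; last exact: measurableC.
rewrite setDE setTI setCK; apply: eq_measure_integral => A mA AD.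
by transitivity (mu (A `&` D)) => //; rewrite setIidl.
Qed.

Lemma Rintegral_lebesgue_on (f : 'rV[R]_d -> R) :
  nu.-integrable setT (EFin \o f) ->
  \int[mu]_(x in D) f x = \int[nu]_x f x.
Proof. by move=> fi; rewrite /Rintegral integral_lebesgue_on. Qed.

Lemma ge0_integral_lebesgue_on (f : 'rV[R]_d -> \bar R) :
  measurable_fun setT f -> (forall x, (0 <= f x)%E) ->
  (forall x, ~ D x -> f x = 0%E) ->
  (\int[mu]_x f x = \int[nu]_x f x)%E.
Proof.
move=> mf f0 fD.
rewrite [RHS](ge0_negligible_integral _ _ _ _ lebesgue_onC)//; last exact: measurableC.
rewrite setDE setTI setCK; transitivity (\int[mu]_(x in D) f x)%E.
  rewrite [RHS]integral_mkcond; apply: eq_integral => x _; rewrite patchE.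
  by case: ifPn => //; rewrite notin_setE => /fD ->.
apply: eq_measure_integral => A mA AD.
by transitivity (mu (A `&` D)) => //; rewrite setIidl.
Qed.

Lemma bounded_Lfun2 (f : 'rV[R]_d -> R) C : measurable_fun setT f ->
  (forall x, `|f x| <= C) -> f \in Lfun nu 2%:E.
Proof.
move=> mf fC; apply/Lfun2P; split=> //.
apply: (@le_lt_trans _ _ (\int[nu]_x (cst (C ^+ 2)%:E x))%E).
  apply: ge0_le_integral => //.
  - by move=> x _; rewrite lee_fin sqr_ge0.
  - by apply/measurable_EFinP/measurable_funX.
  - move=> x _; rewrite lee_fin -(real_normK (num_real (f x))).
    by rewrite lerXn2r ?nnegrE// (le_trans _ (fC x)).
rewrite integral_cst// lte_mul_pinfty// ?lee_fin ?sqr_ge0//.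
exact: lebesgue_on_setT.
Qed.

End lebesgue_on_domain.

Section test_functions.
Context (R : realType) (d : nat) (D : set 'rV[R]_d).
Implicit Types phi psi : 'rV[R]_d -> R.

Lemma test_function_out phi x : test_function D phi -> ~ D x -> phi x = 0.
Proof.
move=> [_ _ sD] nDx; apply: contrapT => px; apply: nDx; apply: sD.
by apply: subset_closure; exact/eqP.
Qed.

Lemma smooth_continuous phi : smooth phi -> continuous phi.
Proof. by move=> /(_ [::])[]. Qed.

Lemma smooth_derivable phi i x : smooth phi -> derivable phi x (delta_mx ord0 i).
Proof. by move=> /(_ [::])[_]; exact. Qed.

Lemma smooth_partial i phi : smooth phi -> smooth (partial i phi).
Proof. by move=> sphi s; have := sphi (rcons s i); rewrite -cats1 foldr_cat. Qed.

Lemma partial_support i phi :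
  [set x | partial i phi x != 0] `<=` closure [set x | phi x != 0].
Proof.
move=> x /= px; apply: contrapT => nx; move/eqP : px; apply.
have near0 : \forall y \near x, phi y = 0.
  have := @closed_closure _ [set x | phi x != 0].
  move=> /closed_openC; rewrite openE => /(_ x nx); rewrite /interior.
  apply: filterS => y ny; apply: contrapT => py.
  by apply: ny; apply: subset_closure; exact/eqP.
by rewrite /partial (@near_eq_derive _ _ _ _ (cst 0)) ?derive_cst.
Qed.

Lemma test_function_partial i phi :
  test_function D phi -> test_function D (partial i phi).
Proof.
move=> [sphi cphi sD].
have sub : closure [set x | partial i phi x != 0] `<=` closure [set x | phi x != 0].
  by rewrite closureE; apply: smallest_sub; [exact: closed_closure|exact: partial_support].
split; first exact: smooth_partial.
- exact: subclosed_compact (@closed_closure _ _) cphi sub.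
- exact: subset_trans sub sD.
Qed.

Lemma test_function_bounded phi : test_function D phi ->
  exists C, forall x, `|phi x| <= C.
Proof.
move=> [/smooth_continuous cphi cK _].
have : compact (phi @` closure [set x | phi x != 0]).
  by apply: continuous_compact => //; exact: continuous_subspaceT.
move=> /compact_bounded[C [_ HC]]; exists (`|C| + 1) => x.
have C1 : C < `|C| + 1 by rewrite (le_lt_trans (ler_norm C))// ltrDl.
have [->|px] := eqVneq (phi x) 0; first by rewrite normr0 addr_ge0.
by apply: HC C1 _ _; exists x => //; exact: subset_closure.
Qed.

Lemma test_function_measurable phi : test_function D phi ->
  measurable_fun setT phi.
Proof.
move=> [/smooth_continuous cphi _ _].
by apply: continuous_measurable_rV => [|x _]; [exact: openT|exact: cphi].
Qed.

Hypothesis hD : convex_polyhedral_domain D.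

Lemma test_function_Lfun2 phi : test_function D phi ->
  phi \in Lfun (lebesgue_on hD) 2%:E.
Proof.
move=> tphi; have [C phiC] := test_function_bounded tphi.
exact: bounded_Lfun2 (test_function_measurable tphi) phiC.
Qed.

End test_functions.

Lemma poincare_test_function (R : realType) (d : nat) (D : set 'rV[R]_d.+1)
    (hD : convex_polyhedral_domain D) :
  exists2 C : R, 0 < C & forall phi, test_function D phi ->
    norm2 (lebesgue_on hD) phi <= C * norm2 (lebesgue_on hD) (partial ord0 phi).
Proof.
have [_ /bounded_set_cbox[M M0 DM] _] := hD.
(* D lies in the cube |x_i| <= M, so a test function vanishes once |x_0| >= M + 1; the square of the
   constant is the factor 4 (M + 1)^2 of [poincare_first_coord]. *)
exists (2 * (M + 1)) => [|phi tphi]; first by rewrite mulr_gt0// addr_gt0.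
have tdphi := test_function_partial ord0 tphi.
have [phiL dphiL] := (test_function_Lfun2 hD tphi, test_function_Lfun2 hD tdphi).
have M10 : 0 < M + 1 by rewrite addr_gt0.
rewrite -(@ler_pXn2r _ 2) ?nnegrE ?mulr_ge0 ?norm2_ge0 ?(ltW M10)//.
rewrite exprMn !sqr_norm2 -lee_fin EFinM !EFin_inner//.
have E psi : test_function D psi ->
    (\int[lebesgue_on hD]_x (psi x ^+ 2)%:E =
     \int[lebesgue_rV R d.+1]_x (psi x ^+ 2)%:E)%E.
  move=> tpsi; rewrite -(ge0_integral_lebesgue_on hD)//.
  - by apply/measurable_EFinP/measurable_funX; exact: test_function_measurable tpsi.
  - by move=> x; rewrite lee_fin sqr_ge0.
  - by move=> x /(test_function_out tpsi) ->; rewrite expr0n.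
rewrite !E// exprMn (_ : 2 ^+ 2 = 4); last by ring.
apply: poincare_first_coord => //.
- by have [/smooth_continuous] := tphi.
- by have [/smooth_continuous] := tdphi.
- by move=> x; have [sphi _ _] := tphi; exact: smooth_derivable.
- move=> x Mx; apply: (test_function_out tphi) => Dx.
  have := DM _ Dx ord0; rewrite !mxE -ler_norml => H.
  by have := le_trans Mx H; rewrite gerDl ler10.
Qed.

(** * Test functions and the du Bois-Reymond lemma *)

Section flat_functions.
Context {R : realType}.
Implicit Types (p : {poly R}) (x t : R).

(** The polynomial factor makes the family of functions p(1/x) exp(-1/x) closed under
    differentiation, so one derivative rule yields smoothness of the classical profile exp(-1/x). *)
Definition flat p x : R := if 0 < x then p.[x^-1] * expR (- x^-1) else 0.

Lemma flat_le0 p x : x <= 0 -> flat p x = 0.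
Proof. by rewrite /flat leNgt => /negbTE ->. Qed.

Lemma flat_gt0 p x : 0 < x -> flat p x = p.[x^-1] * expR (- x^-1).
Proof. by rewrite /flat => ->. Qed.

(* From [expR t >= t ^+ n / n`!] with [n = size p]. *)
Lemma flat_bound p :
  exists2 C, 0 <= C & forall x, `|x| <= 1 -> `|flat p x| <= C * `|x|.
Proof.
pose S : R := \sum_(i < size p) `|p`_i|; pose n := size p.
exists (S * n.+1`!%:R) => [|x x1].
  by rewrite mulr_ge0 ?sumr_ge0.
have S0 : 0 <= S by rewrite sumr_ge0.
have [x0|x0] := leP x 0; first by rewrite flat_le0// normr0 !mulr_ge0.
rewrite flat_gt0// (gtr0_norm x0); set t := x^-1.
have t0 : 0 < t by rewrite invr_gt0.
have t1 : 1 <= t by rewrite -invr1 lef_pV2 ?posrE// (le_trans (ler_norm x)).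
have pt : `|p.[t]| <= S * t ^+ n.
  rewrite horner_coef (le_trans (ler_norm_sum _ _ _))// mulr_suml ler_sum// => i _.
  rewrite normrM ler_wpM2l// ger0_norm ?exprn_ge0 ?(ltW t0)//.
  by rewrite ler_weXn2l// ltnW.
have et : expR (- t) <= n.+1`!%:R * x ^+ n.+1.
  rewrite expRN -(invrK x) -/t exprVn -[n.+1`!%:R]invrK -invfM lef_pV2 ?posrE ?expR_gt0//; last first.
    by rewrite mulr_gt0 ?exprn_gt0// invr_gt0 ltr0n fact_gt0.
  by rewrite (le_trans _ (expR_ge1Dxn n (ltW t0)))// mulrC ler_wpDl.
rewrite normrM (ger0_norm (expR_ge0 _)).
apply: (@le_trans _ _ (S * t ^+ n * (n.+1`!%:R * x ^+ n.+1))).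
  by apply: ler_pM => //; exact: expR_ge0.
have tx : t ^+ n * x ^+ n = 1 by rewrite -exprMn mulVf ?gt_eqF// expr1n.
rewrite exprS mulrACA [x * _]mulrC -!mulrA ler_wpM2l//.
by rewrite [t ^+ n * _]mulrA tx mul1r.
Qed.

Lemma flat_divX p x : x^-1 * flat p x = flat ('X * p) x.
Proof.
have [x0|x0] := leP x 0; first by rewrite !flat_le0// mulr0.
by rewrite !flat_gt0// hornerM hornerX mulrA.
Qed.

Lemma flat_cvg0 p : flat p x @[x --> 0^'] --> (0 : R).
Proof.
have [C C0 HC] := flat_bound p.
apply: (@cvg_to_0_linear _ _ C 1) => // r /andP[_ /ltW]; exact: HC.
Qed.

(** For x > 0 the derivative of p(1/x) exp(-1/x) is x^-2 (p - p')(1/x) exp(-1/x), and x^-2 is the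
    value of ['X^2] at 1/x. *)
Definition flat_deriv p : {poly R} := 'X^2 * (p - p^`()).

Lemma flat_is_derive p x : is_derive x (1 : R) (flat p) (flat (flat_deriv p) x).
Proof.
have [x0|x0|<-] := ltgtP 0 x.
- apply: (@near_eq_is_derive _ R^o R^o (fun y => p.[y^-1] * expR (- y^-1))).
    near=> y; rewrite flat_gt0//.
    by near: y; apply: (@open_nbhs_nbhs _ x); split; [exact: open_gt|exact: x0].
  have dV : is_derive x (1 : R) (fun y : R => y^-1) (- x ^- 2 *: 1).
    by apply: (@is_deriveV _ id); rewrite ?gt_eqF.
  have dp : is_derive x (1 : R) (fun y : R => p.[y^-1]) (p^`().[x^-1] * (- x ^- 2 *: 1)).
    exact: (@is_derive1_comp _ (horner p) (fun y : R => y^-1)).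
  have dN : is_derive x (1 : R) (fun y : R => - y^-1) (- (- x ^- 2 *: 1)).
    exact: is_deriveN.
  have de : is_derive x (1 : R) (fun y : R => expR (- y^-1)) (expR (- x^-1) * - (- x ^- 2 *: 1)).
    exact: (@is_derive1_comp _ expR (fun y : R => - y^-1)).
  apply: (@is_derive_eq _ _ _ _ _ _ _ _ (is_deriveM dp de)).
  rewrite flat_gt0// /flat_deriv hornerM hornerXn hornerD hornerN /GRing.scale/=.
  by rewrite -exprVn; ring.
- rewrite (flat_le0 _ (ltW x0)).
  apply: (@near_eq_is_derive _ R^o R^o (cst 0)).
  near=> y; rewrite flat_le0//; apply: ltW.
  by near: y; apply: (@open_nbhs_nbhs _ x); split; [exact: open_lt|exact: x0].
(* At the origin the difference quotient is itself a flat function, with polynomial ['X * p], and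
   thus tends to 0. *)
have H : (fun h : R => h^-1 *: ((flat p \o shift 0) (h *: (1:R)) - flat p 0)) =
    flat ('X * p).
  apply/funext => h /=; rewrite addr0 (flat_le0 p (lexx 0)) subr0.
  by rewrite [X in flat p X]mulr1 -flat_divX.
rewrite (flat_le0 _ (lexx 0)); split.
  by rewrite /derivable H; apply/cvg_ex; exists 0; exact: flat_cvg0.
by rewrite /derive H; apply/cvg_lim => //; exact: flat_cvg0.
Unshelve. all: by end_near. Qed.

Lemma flat1_ge0 x : 0 <= flat 1 x.
Proof.
have [x0|x0] := leP x 0; first by rewrite flat_le0.
by rewrite flat_gt0// hornerC mul1r expR_ge0.
Qed.

Lemma flat1_le1 x : flat 1 x <= 1.
Proof.
have [x0|x0] := leP x 0; first by rewrite flat_le0.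
by rewrite flat_gt0// hornerC mul1r -expR0 ler_expR oppr_le0 invr_ge0 ltW.
Qed.

Lemma flat1_scale_cvg x :
  flat 1 (n.+1%:R * x) @[n --> \oo] --> ((0 < x)%R%:R : R).
Proof.
have [x0|x0] := leP x 0.
  under eq_fun do rewrite flat_le0 ?mulr_ge0_le0//.
  exact: cvg_cst.
under eq_fun do rewrite flat_gt0 ?mulr_gt0// hornerC mul1r.
suff H : - (n.+1%:R * x)^-1 @[n --> \oo] --> (- (0 * x^-1) : R).
  have := continuous_cvg _ (@continuous_expR R _) H => /(_ _).
  by rewrite mul0r oppr0 expR0; apply.
apply: cvgN; under eq_fun do rewrite invfM.
by apply: cvgMr_tmp; exact: cvg_harmonic.
Qed.

End flat_functions.

Section tensor_products.
Context {R : realType} (d : nat).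
Implicit Types (h k : 'I_d -> R -> R) (S : set (R -> R)).

(** This is what makes a product of one-variable functions from S smooth: iterated partial
    derivatives stay products of members of S. *)
Definition derivation_closed S := forall f, S f ->
  exists2 g, S g & forall t, is_derive t (1 : R) f (g t).

Definition tensor h (x : 'rV[R]_d) : R := \prod_i h i (x ord0 i).

Lemma tensor_is_derive h i (g : R -> R) (x : 'rV[R]_d) :
  is_derive (x ord0 i) (1 : R) (h i) (g (x ord0 i)) ->
  is_derive x (delta_mx ord0 i) (tensor h)
    (tensor (fun j => if j == i then g else h j) x).
Proof.
move=> dh; pose c := \prod_(j | j != i) h j (x ord0 j).
have E (t : R) : tensor h (t *: delta_mx ord0 i + x) = h i (t + x ord0 i) * c.
  rewrite /tensor (bigD1 i)//= !mxE !eqxx/= mulr1; congr (_ * _).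
  by apply: eq_bigr => j ji; rewrite !mxE (negbTE ji) andbF mulr0 add0r.
have dhc : is_derive (x ord0 i) (1 : R) (fun s => h i s * c) (g (x ord0 i) * c).
  apply: is_derive_eq.
  by rewrite scaler0 add0r /GRing.scale/= mulrC.
have H : (fun t : R => t^-1 *: ((tensor h \o shift x) (t *: delta_mx ord0 i) - tensor h x)) =
    (fun t : R => t^-1 *: (((fun s => h i s * c) \o shift (x ord0 i)) (t *: (1 : R))
      - h i (x ord0 i) * c)).
  apply/funext => t; rewrite /= E scaler1; congr (_ *: (_ - _)).
  by have := E 0; rewrite scale0r !add0r.
have -> : tensor (fun j => if j == i then g else h j) x = g (x ord0 i) * c.
  rewrite /tensor (bigD1 i)//= eqxx; congr (_ * _).
  by apply: eq_bigr => j /negbTE ->.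
have [dc1 dc2] := dhc.
by split; [rewrite /derivable H|rewrite /derive H].
Qed.

Lemma tensor_continuous h : (forall i, continuous (h i)) -> continuous (tensor h).
Proof.
move=> ch; apply: (@continuous_big _ _ _ _ _ _ 'rV[R]_d) => [|i _ x].
  exact: mul_continuous.
exact: (continuous_comp (@coord_continuous R 1 d ord0 i x) (ch i _)).
Qed.

Lemma tensor_smooth S h : derivation_closed S -> (forall i, S (h i)) ->
  smooth (tensor h).
Proof.
move=> SS Sh s.
have [k Sk ->] : exists2 k, forall i, S (k i) & foldr (@partial R d) (tensor h) s = tensor k.
  elim: s => [|i s [k Sk IH]]; first by exists h.
  have [g Sg dg] := SS _ (Sk i).
  exists (fun j => if j == i then g else k j); first by move=> j; case: ifP.
  rewrite /= IH; apply/funext => x; rewrite /partial.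
  by have [_] := tensor_is_derive (dg (x ord0 i)).
split=> [|i x]; last first.
  have [g Sg dg] := SS _ (Sk i).
  by have [] := tensor_is_derive (dg (x ord0 i)).
apply: tensor_continuous => i t; have [g _ dg] := SS _ (Sk i).
by apply/differentiable_continuous/derivable1_diffP; have [] := dg t.
Qed.

End tensor_products.

Section bumps.
Context {R : realType}.
Implicit Types (a b t : R) (n : nat) (s : seq ({poly R} * {poly R})).

(** Finite sums are needed because the product rule turns one product of two flat functions into
    two; the list of polynomial pairs records all iterated derivatives of a one-dimensional bump on
    (a, b). *)
Definition flat_sum a b n s t : R :=
  \sum_(pq <- s) flat pq.1 (n.+1%:R * (t - a)) * flat pq.2 (n.+1%:R * (b - t)).

Lemma flat_sum_derivation_closed a b n :
  derivation_closed [set f | exists s, f = flat_sum a b n s].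
Proof.
move=> _ [s ->].
(* Each pair gives two by the product rule; the inner derivatives n+1 and -(n+1) of the affine
   arguments are absorbed into the polynomials. *)
exists (flat_sum a b n (flatten [seq [:: (n.+1%:R *: flat_deriv pq.1, pq.2);
   (pq.1, (- n.+1%:R) *: flat_deriv pq.2)] | pq <- s])); first by eexists.
move=> t; elim: s => [|[p q] s IH].
  rewrite /flat_sum /= big_nil.
  by under eq_fun do rewrite big_nil; exact: is_derive_cst.
rewrite /flat_sum /=; under eq_fun do rewrite big_cons.
rewrite !big_cons /= addrA; apply: is_deriveD.
have flatZ c r u : flat (c *: r) u = c * flat r u :> R.
  by rewrite /flat; case: ifP; rewrite ?mulr0// hornerZ mulrA.
have d1 : is_derive t (1 : R) (fun t => n.+1%:R * (t - a)) n.+1%:R.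
  apply: is_derive_eq.
  by rewrite /GRing.scale/= subr0 mulr1.
have d2 : is_derive t (1 : R) (fun t => n.+1%:R * (b - t)) (- n.+1%:R).
  apply: is_derive_eq.
  by rewrite /GRing.scale/= add0r mul1r mulrN1.
have e1 := @is_derive1_comp _ (flat p) _ _ _ _ (flat_is_derive p _) d1.
have e2 := @is_derive1_comp _ (flat q) _ _ _ _ (flat_is_derive q _) d2.
apply: (@is_derive_eq _ _ _ _ _ _ _ _ (is_deriveM e1 e2)).
by rewrite /GRing.scale/= !flatZ; ring.
Qed.

End bumps.

Section box_bumps.
Context {R : realType} (d : nat).
Implicit Types (a b x : 'rV[R]_d) (n : nat).

(** A smooth function with values in [0, 1], zero outside the open box, that converges pointwise to
    the indicator of the box as n grows. *)
Definition bump a b n : 'rV[R]_d -> R :=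
  tensor (fun i t => flat 1 (n.+1%:R * (t - a ord0 i)) *
                     flat 1 (n.+1%:R * (b ord0 i - t))).

Lemma bump_smooth a b n : smooth (bump a b n).
Proof.
pose S := [set f : R -> R | exists i, exists s, f = flat_sum (a ord0 i) (b ord0 i) n s].
apply: (@tensor_smooth _ _ S) => [f [i [s ->]]|i].
  have [|g [r ->] dg] := @flat_sum_derivation_closed R (a ord0 i) (b ord0 i) n
    (flat_sum (a ord0 i) (b ord0 i) n s); first by exists s.
  by exists (flat_sum (a ord0 i) (b ord0 i) n r) => //; exists i, r.
exists i, [:: (1, 1)]; apply/funext => t.
by rewrite /flat_sum big_cons big_nil addr0.
Qed.

Lemma bump_ge0 a b n x : 0 <= bump a b n x.
Proof. by apply: prodr_ge0 => i _; rewrite mulr_ge0 ?flat1_ge0. Qed.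

Lemma bump_le1 a b n x : bump a b n x <= 1.
Proof.
apply: prodr_ile1 => i _.
by rewrite mulr_ge0 ?flat1_ge0//= mulr_ile1 ?flat1_ge0 ?flat1_le1.
Qed.

Lemma bump_out a b n x : ~ box a b x -> bump a b n x = 0.
Proof.
move=> nx; have [i] : exists i, ~ (a ord0 i < x ord0 i < b ord0 i).
  by apply/existsNP => H; exact: nx.
move=> /negP ni; rewrite /bump /tensor (bigD1 i)//=.
suff -> : flat 1 (n.+1%:R * (x ord0 i - a ord0 i)) *
    flat 1 (n.+1%:R * (b ord0 i - x ord0 i)) = 0 :> R by rewrite mul0r.
move: ni; rewrite negb_and -!leNgt => /orP[] le_.
  by rewrite flat_le0 ?mul0r// mulr_ge0_le0// subr_le0.
by rewrite [X in _ * X]flat_le0 ?mulr0// mulr_ge0_le0// subr_le0.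
Qed.

Lemma bump_cvg a b x : bump a b n x @[n --> \oo] --> (\1_(box a b) x : R).
Proof.
have H : bump a b n x @[n --> \oo] -->
    \prod_i ((0 < x ord0 i - a ord0 i)%R%:R * (0 < b ord0 i - x ord0 i)%R%:R : R).
  apply: cvg_big => [|i _]; first exact: mul_continuous.
  by apply: cvgM; exact: flat1_scale_cvg.
suff -> : \1_(box a b) x =
    \prod_i ((0 < x ord0 i - a ord0 i)%R%:R * (0 < b ord0 i - x ord0 i)%R%:R : R) by [].
rewrite indicE; have [xab|nx] := pselect (box a b x).
  rewrite mem_set// big1// => i _; have /andP[xa xb] := xab i.
  by rewrite !subr_gt0 xa xb mulr1.
have [i] : exists i, ~ (a ord0 i < x ord0 i < b ord0 i).
  by apply/existsNP => H'; exact: nx.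
rewrite memNset// => /negP/negbTE ni; rewrite (bigD1 i)//=.
by rewrite !subr_gt0 -natrM mulnb ni mul0r.
Qed.

Lemma cbox_compact a b : compact (cbox a b).
Proof.
have -> : cbox a b = [set v : 'rV[R]_d | forall i, `[a ord0 i, b ord0 i]%classic (v ord0 i)].
  by apply/seteqP; split=> x H i; have := H i; rewrite /= in_itv.
apply: (@rV_compact _ _ (fun i => `[a ord0 i, b ord0 i]%classic)) => i.
exact: segment_compact.
Qed.

Lemma bump_test_function (D : set 'rV[R]_d) a b n : cbox a b `<=` D ->
  test_function D (bump a b n).
Proof.
move=> abD; have sub : closure [set x | bump a b n x != 0] `<=` cbox a b.
  rewrite closureE; apply: smallest_sub.
    by apply: compact_closed; [exact: norm_hausdorff|exact: cbox_compact].
  move=> x /= /eqP bx; have xab : box a b x by apply: contrapT => /bump_out.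
  by move=> i; have /andP[/ltW -> /ltW ->] := xab i.
split; first exact: bump_smooth.
- exact: subclosed_compact (@closed_closure _ _) (@cbox_compact a b) sub.
- exact: subset_trans sub abD.
Qed.

End box_bumps.

Lemma box_setI (R : realType) d (a b a' b' : 'rV[R]_d) :
  box a b `&` box a' b' =
  box (\row_i Num.max (a ord0 i) (a' ord0 i)) (\row_i Num.min (b ord0 i) (b' ord0 i)).
Proof.
apply/seteqP; split=> [x [H H'] i|x H].
  by rewrite !mxE gt_max lt_min; have /andP[-> ->] := H i; have /andP[-> ->] := H' i.
by split=> i; have := H i; rewrite !mxE gt_max lt_min => /andP[/andP[h1 h2] /andP[h3 h4]];
  rewrite ?h1 ?h2 ?h3 ?h4.
Qed.

(** Together with [box_setI] this presents the sigma-algebra as generated by a pi-system, as the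
    Dynkin argument below requires. *)
Lemma measurable_rV_boxes (R : realType) d : @measurable _ 'rV[R]_d =
  <<s [set A | exists a b : 'rV[R]_d, A = box a b] >>.
Proof.
set G := [set A | _]; apply/seteqP; split; last first.
  by apply: smallest_sub; [exact: sigma_algebra_measurable|move=> _ [a [b ->]]; exact: box_measurable].
have sG : sigma_algebra setT <<s G >> by exact: smallest_sigma_algebra.
have [s0 sC sU] := sG.
apply: smallest_sub => // A; rewrite -bigcup_seq => -[i _ [B mB <-]]; rewrite setTI.
suff : <<s @RGenOInfty.G R >> `<=` [set B | <<s G >> (rV_coord i @^-1` B)].
  by apply; move: mB; rewrite /measurableTypeR RGenOInfty.measurableE.
apply: smallest_sub.
  split => /=.
  - by rewrite preimage_set0.
  - by move=> C /sC.
  - by move=> F GF; rewrite preimage_bigcup; exact: sU.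
move=> _ [r ->] /=.
have -> : rV_coord i @^-1` `]r, +oo[%classic =
    \bigcup_n box (\row_j if j == i then r else - n%:R) (const_mx n%:R).
  apply/seteqP; split=> [x /=|x [n _ /(_ i)]]; last first.
    by rewrite !mxE eqxx /= in_itv/= andbT => /andP[].
  rewrite in_itv/= andbT => rx; exists (Num.bound `|x|) => // j.
  have : `|x ord0 j| < (Num.bound `|x|)%:R.
    by rewrite (le_lt_trans (ler_coord_norm x j))// -[X in X < _]normr_id unstable.ltr_norm_bound.
  by rewrite !mxE ltr_norml => /andP[H1 ->]; rewrite andbT; case: eqP => [->|].
by apply: sU => n; apply: sub_sigma_algebra; do 2 eexists.
Qed.

Lemma Lfun2_integrable (R : realType) d (D : set 'rV[R]_d)
    (hD : convex_polyhedral_domain D) (g : 'rV[R]_d -> R) :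
  g \in Lfun (lebesgue_on hD) 2%:E ->
  (lebesgue_on hD).-integrable setT (EFin \o g).
Proof.
move=> gL; apply/Lfun1_integrable; apply: Lfun_subset12 gL.
by rewrite ge0_fin_numE// lebesgue_on_setT.
Qed.

Section du_bois_reymond.
Context (R : realType) (d : nat) (D : set 'rV[R]_d).
Hypothesis hD : convex_polyhedral_domain D.
Local Notation nu := (lebesgue_on hD).
Variable g : 'rV[R]_d -> R.
Hypothesis gL : g \in Lfun nu 2%:E.
Hypothesis g_test : forall phi, test_function D phi -> inner nu g phi = 0.

Let mg : measurable_fun setT g. Proof. exact: Lfun2_measurable gL. Qed.

(** The bumps are test functions, so their integrals against g vanish; dominated convergence, with
    |g| as bound, passes to the indicator of the box. *)
Lemma integral_box_eq0 (a b : 'rV[R]_d) : cbox a b `<=` D ->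
  (\int[nu]_(x in box a b) (g x)%:E = 0)%E.
Proof.
move=> abD; pose f n x := (g x * bump a b n x)%:E : \bar R.
have mbump n : measurable_fun setT (bump a b n).
  exact: test_function_measurable (bump_test_function n abD).
have [_ _ H] := @dominated_convergence _ _ _ nu setT measurableT f
  (fun x => (g x * \1_(box a b) x)%:E) (fun x => `|g x|%:E)
  ltac:(by move=> n; apply/measurable_EFinP; exact: measurable_funM)
  ltac:(by apply/measurable_EFinP; apply: measurable_funM => //; apply: measurable_indic; exact: box_measurable)
  ltac:(by apply: nearW => x _; apply: cvg_EFin; [exact: nearW|apply: cvgM; [exact: cvg_cst|exact: bump_cvg]])
  ltac:(by have /integrable_norm := Lfun2_integrable gL)
  ltac:(by apply: nearW => x n _; rewrite /f lee_fin normrM ler_piMr// ger0_norm ?bump_ge0// bump_le1).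
have f0 n : (\int[nu]_x f n x = 0)%E.
  have tb := bump_test_function n abD.
  have /integrable_fin_num := integrable_mul gL (test_function_Lfun2 hD tb).
  by move=> /(_ measurableT) /fineK <-; have := g_test tb; rewrite /inner /Rintegral => ->.
move: H; under eq_fun do rewrite f0.
move=> /cvg_lim; rewrite lim_cst// => /(_ (@ereal_hausdorff R)).
move=> H0; rewrite integral_mkcond [RHS]H0; apply: eq_integral => x _.
by rewrite patchE indicE; case: ifP => _; rewrite ?mulr1 ?mulr0.
Qed.

(** Dynkin's theorem extends the previous lemma from boxes to measurable sets. Intersecting with
    [box a b] keeps every box of the argument inside D, where bumps are test functions. *)
Lemma integral_box_trace_eq0 (a b : 'rV[R]_d) (A : set 'rV[R]_d) :
  cbox a b `<=` D -> measurable A -> (\int[nu]_(x in A `&` box a b) (g x)%:E = 0)%E.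
Proof.
move=> abD mA.
have gi E : measurable E -> nu.-integrable E (EFin \o g).
  by move=> mE; apply: integrableS (Lfun2_integrable gL).
have mQ : measurable (box a b) by exact: box_measurable.
apply: (@dynkin_induction _ 'rV[R]_d _ (fun A => (\int[nu]_(x in A `&` box a b) (g x)%:E = 0)%E)
  (@measurable_rV_boxes R d)); last by rewrite -measurable_rV_boxes.
- by move=> _ _ [a1 [b1 ->]] [a2 [b2 ->]]; rewrite box_setI; do 2 eexists.
- by rewrite setTI; exact: integral_box_eq0.
- move=> _ [a1 [b1 ->]]; rewrite box_setI; apply: integral_box_eq0.
  apply: subset_trans abD => x H i; have := H i; rewrite !mxE ge_max le_min.
  by move=> /andP[/andP[_ ->] /andP[_ ->]].
- move=> S mS PS; have := integral_box_eq0 abD.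
  have mSQ : measurable (S `&` box a b) by exact: measurableI.
  have mCQ : measurable (~` S `&` box a b) by apply: measurableI => //; exact: measurableC.
  rewrite -{1}(setTI (box a b)) -(setUv S) setIUl integral_setU //.
  + by rewrite PS add0e.
  + by apply: measurable_funTS; exact/measurable_EFinP.
  + by apply/disj_set2P; rewrite setIACA setICr set0I.
- move=> F mF tF PF; rewrite setI_bigcupl integral_bigcup.
  + by rewrite eseries0// => k _ _; exact: PF.
  + by apply/trivIsetP => i j _ _ ij; rewrite setIACA; move/trivIsetP : tF => ->//; rewrite set0I.
  + by move=> k; exact: measurableI.
  + by apply: gi; apply: bigcupT_measurable => k; exact: measurableI.
Qed.

Lemma ae_eq0_box (a b : 'rV[R]_d) : cbox a b `<=` D ->
  {ae nu, forall x, box a b x -> g x = 0}.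
Proof.
move=> abD; have mQ : measurable (box a b) by exact: box_measurable.
have := @integral_ae_eq _ _ _ nu (box a b) mQ (cst 0%E) (EFin \o g).
move=> /(_ _ _ _)/wrap[].
- by apply: integrableS (Lfun2_integrable gL).
- exact: measurable_cst.
- move=> E EQ mE; rewrite integral0 -{1}(setIidl EQ).
  exact: integral_box_trace_eq0.
by apply: filterS => x H /H [].
Qed.

(** This yields uniqueness of weak derivatives. D is covered by the countably many rational boxes
    whose closed versions it contains, so the exceptional sets add up to a null set; [unpickle] does
    the enumeration. *)
Lemma du_bois_reymond : g = (fun=> 0) %[ae nu].
Proof.
have H n : {ae nu, forall x, if (unpickle n : option ('rV[rat]_d * 'rV[rat]_d)) is Some q then
    cbox (map_mx ratr q.1) (map_mx ratr q.2) `<=` D ->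
    box (map_mx ratr q.1) (map_mx ratr q.2) x -> g x = 0 else True}.
  case: (unpickle n) => [q|]; last exact: nearW.
  have [qD|nqD] := pselect (cbox (map_mx (ratr : rat -> R) q.1) (map_mx ratr q.2) `<=` D).
    by have := ae_eq0_box qD; apply: filterS => x H _.
  by apply: nearW.
have := ae_foralln H; move: (ae_lebesgue_on hD); apply: filterS2 => x Dx Hx _.
have [q [xq qD]] := nbhs_rat_box (open_nbhs_nbhs (conj (polyhedral_open hD) Dx)).
by have := Hx (pickle q); rewrite pickleK; apply.
Qed.

End du_bois_reymond.

(** * The spaces L^2(D) and H^1_0(D) *)

Section L2_classes.
Context (R : realType) (d : nat) (D : set 'rV[R]_d).
Hypothesis hD : convex_polyhedral_domain D.
Local Notation nu := (lebesgue_on hD).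
Local Notation L := (Lfun nu 2%:E).
Implicit Types (u v : L2 hD) (f g : 'rV[R]_d -> R).

Lemma L2_Lfun u : (u : 'rV[R]_d -> R) \in L.
Proof.
rewrite inE; apply/andP; split; rewrite inE /=.
  exact: (@measurable_funPT _ _ _ _ (repr (LebesgueSpace.sort u))).
by case: u => u [[]].
Qed.

Lemma L2_ae_eq u v : u = v %[ae nu] -> u = v.
Proof.
case: u => u [[hu]]; case: v => v [[hv]] /= uv.
have E : u = v.
  rewrite -(reprK u) -(reprK v); apply/eqmodP.
  by apply/asboolP.
subst v; by rewrite (Prop_irrelevance hu hv).
Qed.

Lemma L2_exists f : f \in L -> exists u : L2 hD, u = f %[ae nu].
Proof.
move=> fL; have mf := Lfun2_measurable fL.
have mf' : measurable_fun setT (f : 'rV[R]_d -> measurableTypeR R) by exact: mf.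
pose h : {mfun 'rV[R]_d >-> measurableTypeR R} :=
  MeasurableFun.Pack (MeasurableFun.Class (isMeasurableFun.phant_Build mf')).
pose c : {mfun_ nu, 'rV[R]_d >-> measurableTypeR R} := (\pi h)%qT.
have cf : c = f %[ae nu].
  have : (repr c == h %[mod {mfun_ nu, 'rV[R]_d >-> measurableTypeR R}])%qT by rewrite reprK.
  by rewrite eqmodE => /asboolP.
have cL : (c : 'rV[R]_d -> R) \in L.
  apply: Lfun2_ae_eq fL _; first exact: (@measurable_funPT _ _ _ _ (repr c)).
  by apply: filterS cf => x H xT; rewrite H.
have cn : finite_norm nu 2%:E (c : 'rV[R]_d -> R).
  by move: cL; rewrite inE => /andP[_]; rewrite inE.
by exists (LebesgueSpace.Pack (LebesgueSpace.Class (isFinLebesgue.phant_Build (lee1n 2) cn))).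
Qed.

(** The default of [xget], a class of the zero function, is only taken when [f] is not square
    integrable. *)
Definition mkL2 f : L2 hD :=
  xget (sval (cid (L2_exists (Lfun2_0 nu)))) [set u | u = f %[ae nu]].

Lemma mkL2E f : f \in L -> mkL2 f = f %[ae nu].
Proof. by move=> fL; rewrite /mkL2; exact: (xgetPex _ (L2_exists fL)). Qed.

Lemma L2normE f : f \in L -> L2norm hD f = norm2 nu f.
Proof. by move=> fL; rewrite /L2norm fine_Lnorm2. Qed.

Lemma L2_norm2_eq u v : norm2 nu (u \- v) = 0 -> u = v.
Proof.
move=> uv0; apply: L2_ae_eq.
have := norm2_eq0 (Lfun2B (L2_Lfun u) (L2_Lfun v)) uv0.
by apply: filterS => x H xT; have /eqP := H xT; rewrite subr_eq0 => /eqP.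
Qed.

(** One operation carries the whole linear structure, so each linearity statement is a single
    equation; the difference u - v is [comb (-1) v u]. *)
Definition comb c u v : L2 hD := mkL2 (fun x => c * u x + v x).

Lemma combE c u v : comb c u v = (fun x => c * u x + v x) %[ae nu].
Proof. by apply: mkL2E; apply: Lfun2_comb; exact: L2_Lfun. Qed.

Lemma inner_comb c u v f : f \in L ->
  inner nu (comb c u v) f = c * inner nu u f + inner nu v f.
Proof.
move=> fL; rewrite -inner_combl ?L2_Lfun//.
by apply: ae_eq_inner; rewrite ?L2_Lfun ?Lfun2_comb ?L2_Lfun//; exact: combE.
Qed.

Lemma norm2_comb_sub c u v f g : f \in L -> g \in L ->
  norm2 nu (comb c u v \- (fun x => c * f x + g x)) <=
  `|c| * norm2 nu (u \- f) + norm2 nu (v \- g).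
Proof.
move=> fL gL; have [uL vL] := (L2_Lfun u, L2_Lfun v).
rewrite (@ae_eq_norm2 _ _ _ _ _ ((fun x => c * (u \- f) x) \+ (v \- g))).
- apply: le_trans (norm2D _ _) _; rewrite ?Lfun2_scale ?Lfun2B//.
  by rewrite norm2Z// Lfun2B.
- by rewrite Lfun2B ?L2_Lfun// Lfun2_comb.
- by rewrite Lfun2D ?Lfun2B// Lfun2_scale ?Lfun2B.
- apply: filterS (combE c u v) => x H xT /=; rewrite (H xT).
  by ring.
Qed.

End L2_classes.

Section test_function_algebra.
Context (R : realType) (d : nat) (D : set 'rV[R]_d).
Implicit Types phi psi : 'rV[R]_d -> R.

Lemma partial_comb i c phi psi x : derivable phi x (delta_mx ord0 i) ->
  derivable psi x (delta_mx ord0 i) ->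
  derivable (fun x => c * phi x + psi x) x (delta_mx ord0 i) /\
  partial i (fun x => c * phi x + psi x) x = c * partial i phi x + partial i psi x.
Proof.
move=> dphi dpsi.
have /= H := @is_deriveD _ _ _ _ _ _ _ _ _
  (@is_deriveZ _ _ _ phi c _ _ _ (derivableP dphi)) (derivableP dpsi).
by split; [have [] := H|rewrite /partial; have [_] := H].
Qed.

Lemma foldr_partial_comb c phi psi (s : seq 'I_d) : smooth phi -> smooth psi ->
  foldr (@partial R d) (fun x => c * phi x + psi x) s =
  (fun x => c * foldr (@partial R d) phi s x + foldr (@partial R d) psi s x).
Proof.
move=> sphi spsi; elim: s => //= i s ->; apply/funext => x.
have [_ dphi] := sphi s; have [_ dpsi] := spsi s.
by have [_ ->] := @partial_comb i c _ _ x (dphi i x) (dpsi i x).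
Qed.

Lemma smooth_comb c phi psi : smooth phi -> smooth psi ->
  smooth (fun x => c * phi x + psi x).
Proof.
move=> sphi spsi s; rewrite foldr_partial_comb//.
have [cphi dphi] := sphi s; have [cpsi dpsi] := spsi s; split=> [x|i x].
  apply: (@cvgD _ R^o _ (nbhs (x : 'rV[R]_d))); last exact: cpsi.
  exact: (continuous_comp (cphi x) (@mulrl_continuous R c _)).
by have [] := @partial_comb i c _ _ x (dphi i x) (dpsi i x).
Qed.

Lemma test_function_comb c phi psi : test_function D phi -> test_function D psi ->
  test_function D (fun x => c * phi x + psi x).
Proof.
move=> [sphi kphi Dphi] [spsi kpsi Dpsi].
have sub : closure [set x | c * phi x + psi x != 0] `<=`
    closure [set x | phi x != 0] `|` closure [set x | psi x != 0].
  rewrite closureE; apply: smallest_sub; first by apply: closedU; exact: closed_closure.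
  move=> x /= nz; have [phi0|phi0] := eqVneq (phi x) 0; last by left; exact: subset_closure.
  have [psi0|psi0] := eqVneq (psi x) 0; last by right; exact: subset_closure.
  by move: nz; rewrite phi0 psi0 mulr0 addr0 eqxx.
split; first exact: smooth_comb.
- exact: subclosed_compact (@closed_closure _ _) (compactU kphi kpsi) sub.
- by apply: subset_trans sub _ => x [/Dphi|/Dpsi].
Qed.

Lemma test_function0 : test_function D (fun=> 0 : R).
Proof.
have E (s : seq 'I_d) : foldr (@partial R d) (fun=> 0) s = (fun=> 0).
  elim: s => //= i s ->; apply/funext => x; rewrite /partial.
  exact: (@derive_cst _ _ _ (0 : R)).
have cl : closure [set x : 'rV[R]_d | (0 : R) != 0] = set0.
  by rewrite (_ : [set _ | _] = set0) ?closure0// -subset0 => x /=; rewrite eqxx.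
split; rewrite ?cl//; last exact: compact0.
by move=> s; rewrite E; split=> [|i x]; [exact: cst_continuous|exact: derivable_cst].
Qed.

End test_function_algebra.

Section weak_derivatives.
Context (R : realType) (d : nat) (D : set 'rV[R]_d).
Hypothesis hD : convex_polyhedral_domain D.
Local Notation nu := (lebesgue_on hD).
Local Notation L := (Lfun nu 2%:E).
Local Notation N := (norm2 nu).
Implicit Types (u v y g : L2 hD) (f : 'rV[R]_d -> R).

Lemma Rintegral_inner f h : f \in L -> h \in L ->
  \int[lebesgue_rV R d]_(x in D) (f x * h x) = inner nu f h.
Proof. by move=> fL hL; rewrite (@Rintegral_lebesgue_on _ _ _ hD)//; exact: integrable_mul. Qed.

Lemma is_weak_partialP i y g : is_weak_partial i y g <->
  forall phi, test_function D phi ->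
    inner nu y (partial i phi) = - inner nu g phi.
Proof.
have E phi : test_function D phi ->
    (\int[lebesgue_rV R d]_(x in D) (y x * partial i phi x) =
      inner nu y (partial i phi)) /\
    (\int[lebesgue_rV R d]_(x in D) (g x * phi x) = inner nu g phi).
  move=> tphi; rewrite !Rintegral_inner ?L2_Lfun ?(test_function_Lfun2 hD)//.
  exact: test_function_partial.
by split=> H phi tphi; have := H _ tphi; have [-> ->] := E _ tphi.
Qed.

Lemma is_weak_partial_unique i y g g' :
  is_weak_partial i y g -> is_weak_partial i y g' -> g = g'.
Proof.
move=> /is_weak_partialP H /is_weak_partialP H'; apply: L2_norm2_eq.
have gL : (g \- g') \in L by rewrite Lfun2B ?L2_Lfun.
have g0 : (g \- g') = (fun=> 0) %[ae nu].
  apply: du_bois_reymond => // phi tphi.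
  have pL := test_function_Lfun2 hD tphi.
  rewrite innerBl ?L2_Lfun// -[inner _ g _]opprK -[inner _ g' _]opprK.
  by rewrite -H// -H'// subrr.
rewrite (ae_eq_norm2 gL (Lfun2_0 nu) g0) /norm2 /inner.
by under eq_Rintegral do rewrite mul0r; rewrite /Rintegral integral0 sqrtr0.
Qed.

Lemma weak_partial_eq i y g : is_weak_partial i y g -> weak_partial i y = g.
Proof.
move=> H; apply: (is_weak_partial_unique _ H).
exact: (xgetPex y (ex_intro _ g H)).
Qed.

Lemma H1_weak_partial i y : H1 y -> is_weak_partial i y (weak_partial i y).
Proof. by move=> /(_ i)[g H]; rewrite (weak_partial_eq H). Qed.

Lemma is_weak_partial_comb i c y y' g g' :
  is_weak_partial i y g -> is_weak_partial i y' g' ->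
  is_weak_partial i (comb c y y') (comb c g g').
Proof.
move=> /is_weak_partialP H /is_weak_partialP H'; apply/is_weak_partialP => phi tphi.
have pL := test_function_Lfun2 hD tphi.
have dL := test_function_Lfun2 hD (test_function_partial i tphi).
by rewrite !inner_comb// H// H'//; ring.
Qed.

Lemma L2_sub_test_Lfun y phi : test_function D phi -> (y \- phi) \in L.
Proof. by move=> tphi; rewrite Lfun2B ?L2_Lfun// test_function_Lfun2. Qed.

Lemma L2_sub_partial_Lfun i y phi : test_function D phi -> (y \- partial i phi) \in L.
Proof. by move=> /(test_function_partial i); exact: L2_sub_test_Lfun. Qed.

(** With one test function per tolerance, good for the function and all its derivatives at once,
    sums and limits in [H10] need no sequences of test functions. *)
Lemma H10P y : H10 y <-> H1 y /\ forall e, 0 < e -> exists phi,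
  [/\ test_function D phi, N (y \- phi) <= e &
      forall i, N (weak_partial i y \- partial i phi) <= e].
Proof.
split=> [[hy [phi [tphi py pdy]]]|[hy H]]; split=> //.
  move=> e e0.
  have /cvgr0Pnorm_le/(_ e e0) E1 := py.
  have E2 : \forall n \near \oo, forall i,
      `|L2norm hD (weak_partial i y \- partial i (phi n))| <= e.
    apply: filter_forall => i; by have /cvgr0Pnorm_le/(_ e e0) := pdy i.
  have [n [H1' H2']] := filter_ex (filterI E1 E2).
  exists (phi n); split=> // [|i].
    move: H1'; rewrite L2normE ?L2_sub_test_Lfun//.
    by apply: le_trans; exact: ler_norm.
  move: (H2' i); rewrite L2normE ?L2_sub_partial_Lfun//.
  by apply: le_trans; exact: ler_norm.
have [phi Hphi] : {phi : nat -> 'rV[R]_d -> R & forall n,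
   [/\ test_function D (phi n), N (y \- phi n) <= n.+1%:R^-1 &
      forall i, N (weak_partial i y \- partial i (phi n)) <= n.+1%:R^-1]}.
  apply: (@boolp.choice _ _ (fun n phi => [/\ test_function D phi, N (y \- phi) <= n.+1%:R^-1 &
      forall i, N (weak_partial i y \- partial i phi) <= n.+1%:R^-1])) => n.
  by apply: H; rewrite invr_gt0.
have sq (u : nat -> R) : (forall n, 0 <= u n <= n.+1%:R^-1) -> u n @[n --> \oo] --> 0.
  move=> Hu; apply: (@squeeze_cvgr _ _ _ _ (fun=> 0) harmonic); last exact: cvg_harmonic.
    by apply: nearW => n; exact: Hu.
  exact: cvg_cst.
exists phi; split=> [n||i]; first by have [] := Hphi n.
  apply: sq => n; have [tp H' _] := Hphi n.
  by rewrite L2normE ?L2_sub_test_Lfun// norm2_ge0.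
apply: sq => n; have [tp _ H'] := Hphi n.
by rewrite L2normE ?L2_sub_partial_Lfun// norm2_ge0/=.
Qed.

Lemma H10_comb c y y' : H10 y -> H10 y' ->
  H10 (comb c y y') /\
  forall i, weak_partial i (comb c y y') = comb c (weak_partial i y) (weak_partial i y').
Proof.
move=> /H10P[hy H] /H10P[hy' H'].
have E i : is_weak_partial i (comb c y y') (comb c (weak_partial i y) (weak_partial i y')).
  by apply: is_weak_partial_comb; exact: H1_weak_partial.
have E' i := weak_partial_eq (E i).
split=> //; apply/H10P; split=> [i|e e0].
  by exists (comb c (weak_partial i y) (weak_partial i y')); exact: E.
have c0 : 0 < `|c| + 1 by rewrite ltr_wpDl.
have [phi [tphi h1 h2]] := H (e / (`|c| + 1)) ltac:(by rewrite divr_gt0).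
have [psi [tpsi h1' h2']] := H' (e / (`|c| + 1)) ltac:(by rewrite divr_gt0).
have sum a b : a <= e / (`|c| + 1) -> b <= e / (`|c| + 1) -> `|c| * a + b <= e.
  move=> ha hb; have -> : e = `|c| * (e / (`|c| + 1)) + e / (`|c| + 1).
    by field; rewrite gt_eqF.
  by rewrite lerD// ler_wpM2l.
have tL := test_function_Lfun2 hD.
have tLd i f (tf : test_function D f) := tL _ (test_function_partial i tf).
exists (fun x => c * phi x + psi x); split.
- exact: test_function_comb.
- apply: le_trans (norm2_comb_sub _ _ _ _ _) _; rewrite ?tL//.
  exact: sum.
- move=> i; rewrite E'.
  have -> : partial i (fun x => c * phi x + psi x) =
      (fun x => c * partial i phi x + partial i psi x).
    apply/funext => x; have [sphi _ _] := tphi; have [spsi _ _] := tpsi.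
    by have [_ ->] := @partial_comb _ _ i c phi psi x (smooth_derivable sphi)
      (smooth_derivable spsi).
  apply: le_trans (norm2_comb_sub _ _ _ _ _) _; rewrite ?tLd//.
  exact: sum.
Qed.

(** The weak gradient is a closed operator: its defining identity survives L^2 limits by
    Cauchy-Schwarz. Test functions approximating [v] to within e / 2 then approximate the limit to
    within e. *)
Lemma H10_closed y (g : 'I_d -> L2 hD) :
  (forall e, 0 < e -> exists v, [/\ H10 v, N (v \- y) <= e &
     forall i, N (weak_partial i v \- g i) <= e]) ->
  H10 y /\ forall i, weak_partial i y = g i.
Proof.
move=> H; have LL := @L2_Lfun _ _ _ hD.
have W i : is_weak_partial i y (g i).
  apply/is_weak_partialP => phi tphi.
  have pL := test_function_Lfun2 hD tphi.
  have dL := test_function_Lfun2 hD (test_function_partial i tphi).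
  apply/eqP; rewrite -addr_eq0 -normr_le0.
  apply/ler_addgt0Pl => e e0; rewrite addr0.
  pose M := N phi + N (partial i phi) + 1.
  have M0 : 0 < M by rewrite ltr_wpDl ?addr_ge0 ?norm2_ge0.
  have [v [/H10P[hv _] h1 h2]] := H (e / M) ltac:(by rewrite divr_gt0).
  have /is_weak_partialP/(_ _ tphi) Ev := H1_weak_partial i hv.
  have -> : inner nu y (partial i phi) + inner nu (g i) phi =
      - (inner nu (v \- y) (partial i phi) + inner nu (weak_partial i v \- g i) phi).
    by rewrite !innerBl ?LL// Ev; ring.
  rewrite normrN (le_trans (ler_normD _ _))//.
  have k1 := inner_le (Lfun2B (LL v) (LL y)) dL.
  have k2 := inner_le (Lfun2B (LL (weak_partial i v)) (LL (g i))) pL.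
  have -> : e = e / M * M by rewrite divfK// gt_eqF.
  have eM : 0 <= e / M by rewrite divr_ge0 ?(ltW e0) ?(ltW M0).
  have a1 := ler_wpM2r (norm2_ge0 nu (partial i phi)) h1.
  have a2 := ler_wpM2r (norm2_ge0 nu phi) (h2 i).
  have -> : e / M * M = e / M * N phi + e / M * N (partial i phi) + e / M.
    by rewrite {2}/M; ring.
  apply: (le_trans (lerD (le_trans k1 a1) (le_trans k2 a2))).
  by rewrite [leLHS]addrC ler_wpDr.
have E i := weak_partial_eq (W i).
split=> //; apply/H10P; split=> [i|e e0]; first by exists (g i); exact: W.
have e20 : 0 < e / 2 by rewrite divr_gt0.
have [v [/H10P[hv Hv] h1 h2]] := H _ e20.
have [phi [tphi k1 k2]] := Hv _ e20.
have tL := test_function_Lfun2 hD.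
have tLd i f (tf : test_function D f) := tL _ (test_function_partial i tf).
exists phi; split=> // [|i].
  apply: le_trans (norm2_triangle (g := v) _ _ _) _; rewrite ?LL ?tL ?tLd//.
  by rewrite norm2BC ?LL// [leRHS]splitr lerD.
rewrite E; apply: le_trans (norm2_triangle (g := weak_partial i v) _ _ _) _;
  rewrite ?LL ?tLd//.
by rewrite norm2BC ?LL// [leRHS]splitr lerD.
Qed.

Lemma H10_nonempty : exists y : L2 hD, H10 y.
Proof.
have tL := test_function_Lfun2 hD (@test_function0 R d D).
pose y := mkL2 hD (fun=> 0).
have y0 := mkL2E tL : y = _ %[ae nu].
have yN : N (y \- (fun=> 0)) = 0.
  rewrite (@ae_eq_norm2 _ _ _ _ _ (fun=> 0)) ?Lfun2B ?L2_Lfun//.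
    by rewrite /norm2 /inner; under eq_Rintegral do rewrite mul0r; rewrite /Rintegral integral0 sqrtr0.
  by apply: filterS y0 => x H xT /=; rewrite subr0 (H xT).
have W i : is_weak_partial i y y.
  apply/is_weak_partialP => phi tphi.
  have pL := test_function_Lfun2 hD tphi.
  have dL := test_function_Lfun2 hD (test_function_partial i tphi).
  have Z f : f \in L -> inner nu y f = 0.
    move=> fL; rewrite (ae_eq_inner (L2_Lfun y) tL fL y0) /inner.
    by under eq_Rintegral do rewrite mul0r; rewrite /Rintegral integral0.
  by rewrite !Z// oppr0.
exists y; apply/H10P; split=> [i|e e0]; first by exists y; exact: W.
exists (fun=> 0); split; first exact: test_function0.
  by rewrite yN ltW.
move=> i; rewrite (weak_partial_eq (W i)).
have -> : partial i (fun=> 0) = (fun=> 0 : R) :> ('rV[R]_d -> R).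
  by apply/funext => x; rewrite /partial; exact: (@derive_cst _ _ _ (0 : R)).
by rewrite yN ltW.
Qed.

End weak_derivatives.

Lemma poincare_H10 (R : realType) (d : nat) (D : set 'rV[R]_d.+1)
    (hD : convex_polyhedral_domain D) :
  exists2 C : R, 0 < C & forall y : L2 hD, H10 y ->
    norm2 (lebesgue_on hD) y <= C * norm2 (lebesgue_on hD) (weak_partial ord0 y).
Proof.
have [C C0 HC] := poincare_test_function hD.
exists C => // y /H10P[hy Hy].
have LL := @L2_Lfun _ _ _ hD; have tL := test_function_Lfun2 hD.
have tLd i f (tf : test_function D f) := tL _ (test_function_partial i tf).
apply/ler_addgt0Pl => e e0.
(* The approximation error enters once through [y] and C times through its derivative, whence the
   tolerance e / (1 + C). *)
have [phi [tphi k1 k2]] := Hy (e / (1 + C)) ltac:(by rewrite divr_gt0// addr_gt0).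
have k2' := k2 ord0; have tdphi := test_function_partial ord0 tphi.
have := norm2D (Lfun2B (LL y) (tL _ tphi)) (tL _ tphi).
have -> : (y \- phi) \+ phi = y by apply/funext => x /=; rewrite subrK.
move=> /le_trans; apply.
have := norm2_triangle (tL _ tdphi) (LL (weak_partial ord0 y)) (Lfun2_0 _).
have s0 (f : 'rV[R]_d.+1 -> R) : f \- (fun=> 0) = f by apply/funext => x /=; rewrite subr0.
rewrite !s0 norm2BC ?LL ?tLd// => k3.
have k4 := HC _ tphi.
have E : e = e / (1 + C) + C * (e / (1 + C)).
  by field; rewrite gt_eqF// addr_gt0.
have k5 := ler_wpM2l (ltW C0) (le_trans k3 (lerD k2' (lexx _))).
rewrite [in leRHS]E -addrA -mulrDr.
exact: lerD k1 (le_trans k4 k5).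
Qed.

(** * Weak solutions *)

Section riesz.
Context (R : realType) (T : Type) (X : set T) (comb : R -> T -> T -> T).
Context (B : T -> T -> R) (l : T -> R) (C : R).
Hypothesis X_comb : forall c x y, X x -> X y -> X (comb c x y).
Hypothesis X_nonempty : exists x, X x.
Hypothesis B_sym : forall x y, X x -> X y -> B x y = B y x.
Hypothesis B_comb : forall c x y z, X x -> X y -> X z ->
  B (comb c x y) z = c * B x z + B y z.
Hypothesis B_ge0 : forall x, X x -> 0 <= B x x.
Hypothesis l_comb : forall c x y, X x -> X y -> l (comb c x y) = c * l x + l y.
Hypothesis C_ge0 : 0 <= C.
Hypothesis l_bounded : forall x, X x -> l x ^+ 2 <= C * B x x.
Let sub x y := comb (-1) y x.
Hypothesis B_complete : forall s : nat -> T, (forall n, X (s n)) ->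
  (forall e, 0 < e -> exists N, forall n k, (N <= n)%N -> (N <= k)%N ->
    B (sub (s n) (s k)) (sub (s n) (s k)) <= e) ->
  exists2 y, X y & forall e, 0 < e -> exists N, forall n, (N <= n)%N ->
    B (sub (s n) y) (sub (s n) y) <= e.

Lemma semidefinite_sqr_le x y : X x -> X y -> B x y ^+ 2 <= B x x * B y y.
Proof.
move=> Xx Xy.
have H t : 0 <= t ^+ 2 * B x x + 2 * t * B x y + B y y.
  have Xt := X_comb t Xx Xy; have := B_ge0 Xt.
  rewrite B_comb// (B_sym Xx Xt) (B_sym Xy Xt) !B_comb// (B_sym Xy Xx).
  by move=> h0; apply: le_trans h0 _; rewrite le_eqVlt; apply/orP; left; apply/eqP; ring.
have [x0|x0] := eqVneq (B x x) 0.
  have [->|xy0] := eqVneq (B x y) 0; first by rewrite expr2 x0 !mul0r.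
  have := H (- (B y y + 1) / (2 * B x y)).
  rewrite x0 mulr0 add0r.
  have -> : 2 * (- (B y y + 1) / (2 * B x y)) * B x y = - (B y y + 1) by field.
  by lra.
have xp : 0 < B x x by rewrite lt_def x0 B_ge0.
have := H (- B x y / B x x).
have -> : (- B x y / B x x) ^+ 2 * B x x + 2 * (- B x y / B x x) * B x y + B y y =
  (B x x * B y y - B x y ^+ 2) / B x x by field.
by rewrite pmulr_lge0 ?invr_gt0// subr_ge0.
Qed.

Let F x := B x x - 2 * l x.

(** From 4 l(x)^2 <= 4 C B(x, x) <= (C + B(x, x))^2 follows 2 l(x) <= C + B(x, x). *)
Let F_ge x : X x -> - C <= F x.
Proof.
move=> Xx; have := l_bounded Xx; have := B_ge0 Xx; rewrite /F.
move: (B x x) (l x) => b r b0 h.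
have h2 : (2 * r) ^+ 2 <= (C + b) ^+ 2.
  have : 0 <= (C - b) ^+ 2 by rewrite sqr_ge0.
  by nra.
have h3 : `|2 * r| <= `|C + b|.
  by rewrite -(@ler_pXn2r _ 2) ?nnegrE// !real_normK ?num_real.
have := ler_norm (2 * r); have : `|C + b| = C + b by rewrite ger0_norm ?addr_ge0.
by lra.
Qed.

Let F_comb t v s : X v -> X s ->
  F (comb t v s) = F s + 2 * t * (B s v - l v) + t ^+ 2 * B v v.
Proof.
move=> Xv Xs; have Xt := X_comb t Xv Xs; rewrite /F l_comb// B_comb//.
rewrite (B_sym Xv Xt) (B_sym Xs Xt) !B_comb// (B_sym Xv Xs).
by ring.
Qed.

(** F at the midpoint of x and y is (F x + F y) / 2 - B (x - y) (x - y) / 4, and it is at least m.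
    Hence minimizing sequences are Cauchy. *)
Let F_parallelogram x y m : X x -> X y -> (forall z, X z -> m <= F z) ->
  B (sub x y) (sub x y) <= 2 * (F x + F y - 2 * m).
Proof.
move=> Xx Xy mF; have Xs : X (sub x y) by exact: X_comb.
have := mF _ (X_comb 2^-1 Xs Xy).
have E : B (sub x y) y = - B y y + B x y by rewrite /sub B_comb//; ring.
have E' : l (sub x y) = - l y + l x by rewrite /sub l_comb//; ring.
have E2 : B (sub x y) (sub x y) = B x x - 2 * B x y + B y y.
  rewrite {1}/sub B_comb// (B_sym Xy Xs) (B_sym Xx Xs) E.
  by rewrite /sub B_comb// (B_sym Xy Xx); ring.
rewrite F_comb// (B_sym Xy Xs) E E' E2 /F.
by lra.
Qed.

(** The representer minimizes F = B x x - 2 l x. It is obtained as a limit of near-minimizers, for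
    which the first variation in a direction v is small. *)
Lemma riesz_representation : exists2 y, X y & forall v, X v -> B y v = l v.
Proof.
have [x0 Xx0] := X_nonempty.
pose m := inf (F @` X).
have hF : has_inf (F @` X).
  split; first by exists (F x0), x0.
  by exists (- C) => _ [x Xx <-]; exact: F_ge.
have mF x : X x -> m <= F x.
  by move=> Xx; apply: ge_inf; [exact: hF.2|exists x].
have [s Hs] : {s : nat -> T & forall n, X (s n) /\ F (s n) <= m + n.+1%:R^-1}.
  apply: (@boolp.choice _ _ (fun n x => X x /\ F x <= m + n.+1%:R^-1)) => n.
  have n0 : 0 < n.+1%:R^-1 :> R by rewrite invr_gt0.
  by have [_ [x Xx <-] /ltW] := inf_adherent n0 hF; exists x.
have Xs n : X (s n) := (Hs n).1.
have small (e : R) : 0 < e -> exists N, forall n, (N <= n)%N -> n.+1%:R^-1 <= e.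
  move=> e0; have /cvgr0Pnorm_le/(_ e e0)[N _ HN] := @cvg_harmonic R.
  by exists N => n Nn; have := HN n Nn; rewrite /= ger0_norm.
have [y Xy sy] : exists2 y, X y & forall e, 0 < e -> exists N, forall n, (N <= n)%N ->
    B (sub (s n) y) (sub (s n) y) <= e.
  apply: B_complete => // e e0.
  (* The parallelogram bound is twice the sum of two excesses over m, each at most e / 4. *)
  have [N HN] := small (e / 4) ltac:(by rewrite divr_gt0).
  exists N => n k Nn Nk; apply: le_trans (F_parallelogram (Xs n) (Xs k) mF) _.
  have := HN _ Nn; have := HN _ Nk; have := (Hs n).2; have := (Hs k).2.
  by move: n.+1%:R^-1 k.+1%:R^-1 => p q; lra.
exists y => // v Xv; apply/eqP; rewrite -subr_eq0 -sqrf_eq0 eq_le sqr_ge0 andbT.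
apply/ler_addgt0Pl => e e0; rewrite addr0.
(* With b + 1 in place of b the divisions below are legitimate even if B v v = 0. The choice of q
   gives (b + 1) q = e / 4, so that both r^2 and w^2 are at most e / 4 and (r - w)^2 <= 2 r^2 + 2
   w^2 <= e. *)
set b := B v v; have b0 : 0 <= b by exact: B_ge0.
have b4 : 0 < 4 * (b + 1) by lra.
have [N1 HN1] := small (e / (4 * (b + 1))) ltac:(by rewrite divr_gt0).
have [N2 HN2] := sy (e / (4 * (b + 1))) ltac:(by rewrite divr_gt0).
pose n := maxn N1 N2.
have h1 := HN1 n (leq_maxl _ _); have h2 := HN2 n (leq_maxr _ _).
set q := e / _ in h1 h2.
pose r := B (s n) v - l v.
have r2 : r ^+ 2 <= (b + 1) * q.
  (* Minimality of m is tested at s_n moved along v by a nearly optimal step, which would lower F by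
     r^2 (b + 2) / (b + 1)^2. *)
  have := mF _ (X_comb (- r / (b + 1)) Xv (Xs n)); rewrite F_comb// -/r -/b.
  have h3 := le_trans (Hs n).2 (lerD (lexx m) h1).
  have -> : F (s n) + 2 * (- r / (b + 1)) * r + (- r / (b + 1)) ^+ 2 * b =
    F (s n) - (r ^+ 2 * (b + 2)) / (b + 1) ^+ 2 by field; lra.
  move=> h4; have b1 : 0 < (b + 1) ^+ 2 by rewrite exprn_gt0//; lra.
  have h5 : r ^+ 2 * (b + 2) / (b + 1) ^+ 2 <= q.
    by rewrite -(lerD2l m) (le_trans _ h3)// -lerBrDr.
  rewrite ler_pdivrMr// in h5.
  have h6 : 0 <= r ^+ 2 by rewrite sqr_ge0.
  have h7 : (b + 1) * r ^+ 2 <= (b + 1) * ((b + 1) * q) by lra.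
  by rewrite ler_pM2l in h7 => //; lra.
have Xz : X (sub (s n) y) by exact: X_comb.
have zv := semidefinite_sqr_le Xz Xv; rewrite -/b in zv.
have zE : B (sub (s n) y) v = - B y v + B (s n) v by rewrite /sub B_comb//; ring.
have -> : B y v - l v = r - B (sub (s n) y) v by rewrite zE /r; ring.
move: zv; move: (B (sub (s n) y) v) => w zv.
have bq : (b + 1) * q = e / 4 by rewrite /q; field; lra.
have zv' : w ^+ 2 <= e / 4.
  apply: (le_trans zv); rewrite -bq; apply: le_trans (ler_wpM2r b0 h2) _.
  have q0 : 0 <= q by rewrite /q divr_ge0 ?ltW.
  by lra.
have : 0 <= (r + w) ^+ 2 by rewrite sqr_ge0.
have -> : (r - w) ^+ 2 = 2 * r ^+ 2 + 2 * w ^+ 2 - (r + w) ^+ 2 by ring.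
by rewrite bq in r2; move: r2 zv'; move: (r ^+ 2) (w ^+ 2) ((r + w) ^+ 2) => ? ? ?; lra.
Qed.

End riesz.

(** * The energy form and completeness of H^1_0(D) in the gradient norm *)

Section energy.
Context (R : realType) (d : nat) (D : set 'rV[R]_d.+1).
Hypothesis hD : convex_polyhedral_domain D.
Local Notation nu := (lebesgue_on hD).
Local Notation L := (Lfun nu 2%:E).
Local Notation N := (norm2 nu).
Local Notation wp := (@weak_partial R d.+1 D hD).
Implicit Types (u v y : L2 hD) (a m : 'rV[R]_d.+1 -> R).

Let LL u : (u : 'rV[R]_d.+1 -> R) \in L := L2_Lfun u.

Definition energy m y v : R :=
  \sum_i inner nu (fun x => m x * wp i y x) (wp i v).

Definition grad_norm y : R := Num.sqrt (\sum_i inner nu (wp i y) (wp i y)).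

Lemma grad_norm_ge0 y : 0 <= grad_norm y. Proof. exact: sqrtr_ge0. Qed.

Lemma sqr_grad_norm y : grad_norm y ^+ 2 = \sum_i inner nu (wp i y) (wp i y).
Proof. by rewrite sqr_sqrtr// sumr_ge0// => i _; exact: inner_ge0. Qed.

Lemma norm2_weak_partial_le i y : N (wp i y) <= grad_norm y.
Proof.
rewrite -(@ler_pXn2r _ 2) ?nnegrE ?norm2_ge0 ?grad_norm_ge0// sqr_norm2 sqr_grad_norm.
by rewrite (bigD1 i)//= lerDl sumr_ge0// => j _; exact: inner_ge0.
Qed.

(** Bounding each of the d + 1 directional terms by the full gradient norms costs the factor d + 1,
    which is harmless for the Lipschitz estimate. *)
Lemma energy_norm_le m (M : R) y v : measurable_fun setT m -> (forall x, `|m x| <= M) ->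
  `|energy m y v| <= d.+1%:R * M * grad_norm y * grad_norm v.
Proof.
move=> mm mM; have M0 : 0 <= M := le_trans (normr_ge0 _) (mM 0).
rewrite (le_trans (ler_norm_sum _ _ _))//.
apply: (@le_trans _ _ (\sum_(i < d.+1) M * grad_norm y * grad_norm v)).
  apply: ler_sum => i _; apply: le_trans (inner_le _ _) _ => //; first exact: Lfun2_mul mM _.
  apply: ler_pM; rewrite ?norm2_ge0 ?norm2_weak_partial_le//.
  apply: le_trans (norm2_mul mm mM _) _ => //.
  by rewrite ler_wpM2l// norm2_weak_partial_le.
by rewrite sumr_const card_ord -[leLHS]mulr_natl !mulrA lexx.
Qed.

Lemma weak_partial_comb_ae i c y y' : H10 y -> H10 y' ->
  wp i (comb c y y') = (fun x => c * wp i y x + wp i y' x) %[ae nu].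
Proof. by move=> hy hy'; have [_ ->] := H10_comb c hy hy'; exact: combE. Qed.

Lemma norm2_sub y y' : N (comb (-1) y' y) = N (y \- y').
Proof.
apply: ae_eq_norm2; rewrite ?Lfun2B ?LL//.
by apply: filterS (combE (-1) y' y) => x H xT /=; rewrite (H xT) mulN1r addrC.
Qed.

Lemma norm2_weak_partial_sub i y y' : H10 y -> H10 y' ->
  N (wp i (comb (-1) y' y)) = N (wp i y \- wp i y').
Proof. by move=> hy hy'; have [_ ->] := H10_comb (-1) hy' hy; exact: norm2_sub. Qed.

Lemma energyB m1 m2 (M : R) y v :
  measurable_fun setT m1 -> measurable_fun setT m2 ->
  (forall x, `|m1 x| <= M) -> (forall x, `|m2 x| <= M) ->
  energy (m1 \- m2) y v = energy m1 y v - energy m2 y v.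
Proof.
move=> mm1 mm2 h1 h2; rewrite /energy -sumrB; apply: eq_bigr => i _.
rewrite -innerBl ?LL//; last 2 first.
- exact: Lfun2_mul h1 _.
- exact: Lfun2_mul h2 _.
by congr inner; apply/funext => x /=; rewrite mulrBl.
Qed.

Section bounded_coefficient.
Variables (m : 'rV[R]_d.+1 -> R) (c M : R).
Hypothesis mm : measurable_fun setT m.
Hypothesis mc : forall x, c <= m x <= M.
Hypothesis c0 : 0 < c.

Let mM x : `|m x| <= M.
Proof. by have /andP[cm mM] := mc x; rewrite ger0_norm// (le_trans (ltW c0)). Qed.

Lemma energy_sym y v : energy m y v = energy m v y.
Proof.
apply: eq_bigr => i _; apply: eq_Rintegral => x _.
by rewrite mulrAC.
Qed.

Lemma energy_comb k y y' v : H10 y -> H10 y' -> H10 v ->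
  energy m (comb k y y') v = k * energy m y v + energy m y' v.
Proof.
move=> hy hy' hv; rewrite /energy mulr_sumr -big_split/=; apply: eq_bigr => i _.
have mL u : (fun x => m x * u x) \in L by exact: Lfun2_mul mM _.
rewrite -inner_combl//; apply: ae_eq_inner => //; first exact: Lfun2_comb.
apply: filterS (weak_partial_comb_ae i k hy hy') => x H xT; rewrite (H xT).
by ring.
Qed.

Lemma energy_lower y : c * grad_norm y ^+ 2 <= energy m y y.
Proof.
rewrite sqr_grad_norm mulr_sumr; apply: ler_sum => i _.
have mL : (fun x => m x * wp i y x) \in L by exact: Lfun2_mul mM _.
rewrite -inner_scalel ?LL// -subr_ge0 -innerBl ?Lfun2_scale ?LL//.
apply: Rintegral_ge0 => x _ /=; rewrite -mulrBl -mulrA mulr_ge0 -?expr2 ?sqr_ge0//.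
by rewrite subr_ge0; have /andP[] := mc x.
Qed.

Lemma energy_ge0 y : 0 <= energy m y y.
Proof.
by apply: le_trans (energy_lower y); rewrite mulr_ge0 ?sqr_ge0// ltW.
Qed.

End bounded_coefficient.

Lemma poincare_grad : exists2 C : R, 0 < C & forall y, H10 y -> N y <= C * grad_norm y.
Proof.
have [C C0 HC] := poincare_H10 hD; exists C => // y hy.
apply: le_trans (HC y hy) _; rewrite ler_wpM2l ?(ltW C0)//.
exact: norm2_weak_partial_le.
Qed.

(** Poincare makes the functions themselves Cauchy in L^2, so they and each of their derivatives
    converge separately; [H10_closed] identifies the limits of the derivatives as the derivatives of
    the limit. *)
Lemma H10_complete (s : nat -> L2 hD) : (forall n, H10 (s n)) ->
  (forall e, 0 < e -> exists n0, forall n k, (n0 <= n)%N -> (n0 <= k)%N ->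
     grad_norm (comb (-1) (s k) (s n)) <= e) ->
  exists2 y, H10 y & forall e, 0 < e -> exists n0, forall n, (n0 <= n)%N ->
     grad_norm (comb (-1) y (s n)) <= e.
Proof.
move=> Hs sC; have [C C0 HC] := poincare_grad.
have lim (f : nat -> L2 hD) :
    (forall e : R, 0 < e -> exists n0, forall n k, (n0 <= n)%N -> (n0 <= k)%N ->
       N (f n \- f k) <= e) ->
    exists g : L2 hD, forall e : R, 0 < e -> exists n0, forall n, (n0 <= n)%N ->
       N (f n \- g) <= e.
  move=> fC; have [g gL Hg] := norm2_complete (fun n => LL (f n)) fC.
  exists (mkL2 hD g) => e e0; have [n0 Hn0] := Hg e e0; exists n0 => n /Hn0.
  congr (_ <= _); apply: ae_eq_norm2; rewrite ?Lfun2B ?LL//.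
  by apply: filterS (mkL2E gL) => x H xT /=; rewrite (H xT).
have [y Hy] : exists y : L2 hD, forall e : R, 0 < e -> exists n0, forall n, (n0 <= n)%N ->
    N (s n \- y) <= e.
  apply: lim => e e0; have [n0 Hn0] := sC (e / C) ltac:(by rewrite divr_gt0).
  exists n0 => n k Nn Nk; rewrite -norm2_sub.
  apply: le_trans (HC _ _) _; first by have [] := H10_comb (-1) (Hs k) (Hs n).
  by rewrite mulrC -ler_pdivlMr// Hn0.
have [g Hg] : {g : 'I_d.+1 -> L2 hD & forall i, forall e : R, 0 < e -> exists n0,
    forall n, (n0 <= n)%N -> N (wp i (s n) \- g i) <= e}.
  apply: (@boolp.choice _ _ (fun i g => forall e : R, 0 < e -> exists n0,
    forall n, (n0 <= n)%N -> N (wp i (s n) \- (g : L2 hD)) <= e)) => i.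
  apply: lim => e e0; have [n0 Hn0] := sC _ e0.
  exists n0 => n k Nn Nk; rewrite -norm2_weak_partial_sub//.
  by apply: le_trans (norm2_weak_partial_le _ _) _; exact: Hn0.
have unif e : 0 < e -> exists n0, forall n, (n0 <= n)%N ->
    forall i, N (wp i (s n) \- g i) <= e.
  move=> e0; have [n0 Hn0] : {n0 : 'I_d.+1 -> nat & forall i n, (n0 i <= n)%N ->
      N (wp i (s n) \- g i) <= e}.
    apply: (@boolp.choice _ _ (fun i k => forall n, (k <= n)%N ->
      N (wp i (s n) \- g i) <= e)) => i; exact: Hg.
  exists (\max_i n0 i) => n nn i; apply: Hn0; apply: leq_trans nn.
  exact: leq_bigmax.
have [hy Ey] : H10 y /\ forall i, wp i y = g i.
  apply: H10_closed => e e0; have [n1 H1] := Hy e e0; have [n2 H2] := unif e e0.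
  exists (s (maxn n1 n2)); split=> //; first by rewrite H1// leq_maxl.
  by apply: H2; exact: leq_maxr.
exists y => // e e0.
(* The squared gradient norm is then at most (d + 1) (e / (d + 1))^2 <= e^2. *)
have [n0 Hn0] := unif (e / d.+1%:R) ltac:(by rewrite divr_gt0).
exists n0 => n nn; have H := Hn0 n nn.
rewrite -(@ler_pXn2r _ 2) ?nnegrE ?grad_norm_ge0 ?(ltW e0)// sqr_grad_norm.
apply: (@le_trans _ _ (\sum_(i < d.+1) (e / d.+1%:R) ^+ 2)).
  apply: ler_sum => i _; rewrite -sqr_norm2 (norm2_weak_partial_sub i (Hs n) hy) Ey.
  by rewrite lerXn2r ?nnegrE ?norm2_ge0 ?divr_ge0 ?(ltW e0).
rewrite sumr_const card_ord -[leLHS]mulr_natl expr_div_n mulrCA ler_piMr ?sqr_ge0//.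
rewrite expr2 invfM mulrA divff ?mul1r ?pnatr_eq0//.
by rewrite invf_le1// ler1n.
Qed.

End energy.

Lemma ler_divl_sqr (R : realFieldType) (c g x : R) :
  0 < c -> 0 < g -> c * g ^+ 2 <= x * g -> g <= x / c.
Proof.
move=> c0 g0; rewrite expr2 mulrA ler_pM2r// => h.
by rewrite ler_pdivlMr// mulrC.
Qed.

(** * Existence, uniqueness and stability of the state *)

Section solution_operator.
Context (R : realType) (d : nat) (D : set 'rV[R]_d.+1).
Hypothesis hD : convex_polyhedral_domain D.
Local Notation nu := (lebesgue_on hD).
Local Notation L := (Lfun nu 2%:E).
Local Notation N := (norm2 nu).
Local Notation wp := (@weak_partial R d.+1 D hD).
Implicit Types (u v y : L2 hD) (a b m : 'rV[R]_d.+1 -> R).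

Let LL u : (u : 'rV[R]_d.+1 -> R) \in L := L2_Lfun u.

(** Bounds on the coefficient are known only in D, while [energy] works with functions bounded on
    all of R^d. The constant value off D, chosen between the bounds, is invisible to [nu]. *)
Definition extend k a : 'rV[R]_d.+1 -> R := patch (fun=> k) D a.

Lemma extend_in k a x : D x -> extend k a x = a x.
Proof. by move=> Dx; rewrite /extend /patch mem_set. Qed.

Lemma extend_bounds k a (c M : R) : c <= k <= M -> (forall x, D x -> c <= a x <= M) ->
  forall x, c <= extend k a x <= M.
Proof.
by move=> hk ha x; rewrite /extend /patch; case: ifPn => //; rewrite inE; exact: ha.
Qed.

Lemma measurable_extend k a : measurable_fun D a -> measurable_fun setT (extend k a).
Proof.
move=> ma; have mD := measurable_polyhedral_domain hD.
have -> : extend k a = (a \_ D) \+ (fun x => k * \1_(~` D) x).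
  apply/funext => x; rewrite /extend /= /patch indicE in_setC.
  by case: (x \in D) => /=; [rewrite mulr0 addr0|rewrite mulr1 [X in X + _](_ : _ = 0) ?add0r].
apply: measurable_funD; first exact: (measurable_restrictT a mD).1 ma.
by apply: measurable_funM => //; apply: measurable_indic; exact: measurableC.
Qed.

Lemma energy_integral k a y v : measurable_fun D a ->
  (exists M : R, forall x, `|extend k a x| <= M) ->
  \int[lebesgue_rV R d.+1]_(x in D) (a x * \sum_i wp i y x * wp i v x) =
  energy (extend k a) y v.
Proof.
move=> ma [M aM]; have mm := measurable_extend k ma.
have mL i : (fun x => extend k a x * wp i y x) \in L by exact: Lfun2_mul aM _.
have I i := integrable_mul (mL i) (LL (wp i v)).
have sum_inner (r : seq 'I_d.+1) : nu.-integrable setT (EFin \o (fun x =>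
      \sum_(i <- r) extend k a x * wp i y x * wp i v x)) /\
    \int[nu]_x (\sum_(i <- r) extend k a x * wp i y x * wp i v x) =
    \sum_(i <- r) inner nu (fun x => extend k a x * wp i y x) (wp i v).
  elim: r => [|i r [IH1 IH2]].
    rewrite big_nil; split.
      by apply: eq_integrable (integrable0 nu setT) => // x _ /=; rewrite big_nil.
    by under eq_Rintegral do rewrite big_nil; rewrite /Rintegral integral0.
  rewrite big_cons -IH2 -RintegralD//; split.
    apply: eq_integrable (integrableD measurableT (I i) IH1) => // x _ /=.
    by rewrite big_cons.
  by apply: eq_Rintegral => x _; rewrite big_cons.
have [S1 S2] := sum_inner (index_enum 'I_d.+1).
rewrite /energy -S2 -(Rintegral_lebesgue_on S1); apply: eq_Rintegral => x.
rewrite inE => Dx; rewrite mulr_sumr; apply: eq_bigr => i _.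
by rewrite extend_in// mulrA.
Qed.

(* Otherwise unification compares norms by unfolding the Lebesgue integral. *)
Opaque norm2 inner grad_norm energy.

Section fixed_coefficient.
Variables (a : 'rV[R]_d.+1 -> R) (c M k : R).
Hypothesis ma : measurable_fun D a.
Hypothesis ac : forall x, D x -> c <= a x <= M.
Hypothesis c0 : 0 < c.
Hypothesis ck : c <= k <= M.
Let m := extend k a.

Let mm : measurable_fun setT m. Proof. exact: measurable_extend. Qed.
Let mc x : c <= m x <= M. Proof. exact: extend_bounds. Qed.
Let M0 : 0 <= M. Proof. by have /andP[h1 h2] := ck; rewrite (le_trans _ h2)// (le_trans (ltW c0)). Qed.
Let mM x : `|m x| <= M.
Proof. by have /andP[cm mM] := mc x; rewrite ger0_norm// (le_trans (ltW c0)). Qed.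

Lemma weak_solutionP u y : weak_solution a u y <->
  H10 y /\ forall v, H10 v -> energy m y v = inner nu u v.
Proof.
have E v : \int[lebesgue_rV R d.+1]_(x in D) (u x * v x) = inner nu u v.
  by rewrite Rintegral_inner ?LL.
have E' v := @energy_integral k a y v ma (ex_intro _ M mM).
by split=> [[hy H]|[hy H]]; (split; first exact: hy) => v /H; rewrite E E'.
Qed.

(** Riesz representation for the energy as inner product. The bounds c and M make the energy and
    gradient norms equivalent, which transfers completeness; Poincare bounds the functional v -> <u,
    v>. *)
Lemma weak_solution_exists u : exists y, weak_solution a u y.
Proof.
have [C C0 HC] := poincare_grad hD.
have bounded v : H10 v -> inner nu u v ^+ 2 <= C ^+ 2 * N u ^+ 2 / c * energy m v v.
  move=> hv; have h1 := inner_sqr_le (LL u) (LL v).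
  rewrite (le_trans h1)// -!sqr_norm2 -(ler_pM2l c0).
  have h2 : N v ^+ 2 <= C ^+ 2 * grad_norm v ^+ 2.
    by rewrite -exprMn lerXn2r ?nnegrE ?norm2_ge0 ?mulr_ge0 ?grad_norm_ge0 ?(ltW C0)// HC.
  have h3 := energy_lower mm mc c0 v.
  have -> : c * (C ^+ 2 * N u ^+ 2 / c * energy m v v) =
      C ^+ 2 * N u ^+ 2 * energy m v v by field; rewrite gt_eqF.
  apply: (@le_trans _ _ (C ^+ 2 * N u ^+ 2 * (c * grad_norm v ^+ 2))); last first.
    by rewrite ler_wpM2l// mulr_ge0 ?sqr_ge0.
  have -> : C ^+ 2 * N u ^+ 2 * (c * grad_norm v ^+ 2) =
    c * (N u ^+ 2 * (C ^+ 2 * grad_norm v ^+ 2)) by ring.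
  by rewrite ler_wpM2l ?(ltW c0)// ler_wpM2l ?sqr_ge0.
have complete (s : nat -> L2 hD) : (forall n, H10 (s n)) ->
    (forall e, 0 < e -> exists n0, forall n l, (n0 <= n)%N -> (n0 <= l)%N ->
      energy m (comb (-1) (s l) (s n)) (comb (-1) (s l) (s n)) <= e) ->
    exists2 y, H10 y & forall e, 0 < e -> exists n0, forall n, (n0 <= n)%N ->
      energy m (comb (-1) y (s n)) (comb (-1) y (s n)) <= e.
  move=> Hs sC.
  have Hsub n l : H10 (comb (-1) (s l) (s n)) by have [] := H10_comb (-1) (Hs l) (Hs n).
  have [|y hy Hy] := H10_complete Hs.
    move=> e e0; have [n0 Hn0] := sC (c * e ^+ 2) ltac:(by rewrite mulr_gt0// exprn_gt0).
    exists n0 => n l nn nl; rewrite -(@ler_pXn2r _ 2) ?nnegrE ?grad_norm_ge0 ?(ltW e0)//.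
    by rewrite -(ler_pM2l c0) (le_trans (energy_lower mm mc c0 _))// Hn0.
  exists y; first exact: hy.
  move=> e e0; pose K := d.+1%:R * M + 1.
  have K0 : 0 < K by rewrite ltr_wpDl ?mulr_ge0.
  have [n0 Hn0] := Hy (Num.sqrt (e / K)) ltac:(by rewrite sqrtr_gt0 divr_gt0).
  exists n0 => n nn; have h := Hn0 n nn.
  apply: le_trans (ler_norm _) _; apply: le_trans (energy_norm_le _ _ mm mM) _.
  have h2 : grad_norm (comb (-1) y (s n)) ^+ 2 <= e / K.
    rewrite -[leRHS]sqr_sqrtr ?divr_ge0 ?(ltW e0) ?(ltW K0)//.
    by rewrite lerXn2r ?nnegrE ?grad_norm_ge0 ?sqrtr_ge0.
  rewrite -mulrA -expr2 (le_trans (ler_wpM2l _ h2)) ?mulr_ge0//.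
  by rewrite mulrC mulrAC ler_pdivrMr// ler_wpM2l ?(ltW e0)// /K lerDl.
have K0 : 0 <= C ^+ 2 * N u ^+ 2 / c by rewrite divr_ge0 ?(ltW c0)// mulr_ge0// sqr_ge0.
have Xc q x y : H10 x -> H10 y -> H10 (comb q x y : L2 hD).
  by move=> hx hy; have [] := H10_comb q hx hy.
have l_comb q x y : H10 x -> H10 y ->
    inner nu u (comb q x y : L2 hD) = q * inner nu u x + inner nu u y.
  by move=> _ _; rewrite innerC inner_comb ?LL// !(innerC nu u).
have [y hy Ey] := riesz_representation Xc (@H10_nonempty _ _ _ hD)
  (fun x y _ _ => energy_sym m x y) (energy_comb mm mc c0)
  (fun x _ => energy_ge0 mm mc c0 x)
  l_comb K0 bounded complete.
by exists y; apply/weak_solutionP.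
Qed.

Lemma solution_operatorP u : weak_solution a u (solution_operator a u).
Proof. exact: (xgetPex u (weak_solution_exists u)). Qed.

(** Testing with y itself gives c |grad y|^2 <= <u, y> <= C |u| |grad y|, from which one factor
    cancels. *)
Lemma weak_solution_grad_le C u y : 0 < C -> (forall v, H10 v -> N v <= C * grad_norm v) ->
  weak_solution a u y -> grad_norm y <= C / c * N u.
Proof.
move=> C0 HC /weak_solutionP[hy Ey].
have [->|g0] := eqVneq (grad_norm y) 0.
  by rewrite mulr_ge0 ?norm2_ge0 ?divr_ge0 ?ltW.
have gp : 0 < grad_norm y by rewrite lt_def g0 grad_norm_ge0.
rewrite mulrAC; apply: (ler_divl_sqr c0 gp).
apply: (le_trans (energy_lower mm mc c0 y)); rewrite Ey//.
apply: (le_trans (ler_norm _)); apply: (le_trans (inner_le (LL u) (LL y))).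
rewrite mulrAC [leRHS]mulrC; apply: ler_wpM2l; [exact: norm2_ge0|exact: HC].
Qed.

Lemma weak_solution_unique u y y' : weak_solution a u y -> weak_solution a u y' -> y = y'.
Proof.
move=> /weak_solutionP[hy Ey] /weak_solutionP[hy' Ey'].
have [C C0 HC] := poincare_grad hD.
have [hz _] := H10_comb (-1) hy' hy.
apply: L2_norm2_eq; rewrite -norm2_sub; apply/eqP; rewrite eq_le norm2_ge0 andbT.
rewrite (le_trans (HC _ hz))// -(mulr0 C) ler_pM2l//.
rewrite -(@ler_pXn2r _ 2) ?nnegrE ?grad_norm_ge0// expr0n/= -(ler_pM2l c0) mulr0.
rewrite (le_trans (energy_lower mm mc c0 _))// (energy_comb mm mc c0)// Ey// Ey'//.
by rewrite mulN1r addNr.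
Qed.

Lemma solution_operator_comb q u v :
  solution_operator a (comb q u v) = comb q (solution_operator a u) (solution_operator a v).
Proof.
apply: (weak_solution_unique (solution_operatorP _)); apply/weak_solutionP.
have /weak_solutionP[hu Eu] := solution_operatorP u.
have /weak_solutionP[hv Ev] := solution_operatorP v.
split; first by have [] := H10_comb q hu hv.
by move=> w hw; rewrite (energy_comb mm mc c0)// Eu// Ev// inner_comb.
Qed.

End fixed_coefficient.

(** For z = ya - yb, subtracting the two equations gives E_b(z, z) = E_(b - a)(ya, z), so coercivity
    bounds the gradient of z by delta times that of ya. Both coefficients are extended by the same
    k, so that b - a is small off D too. *)
Lemma weak_solution_perturbation (a b : 'rV[R]_d.+1 -> R) (c M k delta C : R) u ya yb :
  measurable_fun D a -> measurable_fun D b ->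
  (forall x, D x -> c <= a x <= M) -> (forall x, D x -> c <= b x <= M) ->
  0 < c -> c <= k <= M -> (forall x, D x -> `|a x - b x| <= delta) ->
  0 < C -> (forall v, H10 v -> N v <= C * grad_norm v) ->
  weak_solution a u ya -> weak_solution b u yb ->
  N (ya \- yb) <= d.+1%:R * delta * (C / c) ^+ 2 * N u.
Proof.
move=> ma mb ac bc c0 ck ab C0 HC sa sb.
have ga := weak_solution_grad_le ma ac c0 ck C0 HC sa.
have /(weak_solutionP ma ac c0 ck)[ha Ea] := sa.
have /(weak_solutionP mb bc c0 ck)[hb Eb] := sb.
have [x0 Dx0] : D !=set0 by have [] := hD.
have delta0 : 0 <= delta := le_trans (normr_ge0 _) (ab _ Dx0).
have dd0 : 0 <= d.+1%:R * delta by rewrite mulr_ge0.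
have [z zE] : exists z, z = comb (-1) yb ya by exists (comb (-1) yb ya).
have hz : H10 z by rewrite zE; have [] := H10_comb (-1) hb ha.
have mma := measurable_extend k ma; have mmb := measurable_extend k mb.
pose e x := extend k b x - extend k a x.
have me : measurable_fun setT e by exact: measurable_funB.
have eD x : `|e x| <= delta.
  rewrite /e /extend /patch; case: ifPn => [|_]; last by rewrite subrr normr0.
  by rewrite inE distrC; exact: ab.
have bM x : `|extend k b x| <= M.
  have /andP[h1 h2] := extend_bounds ck bc x.
  by rewrite ger0_norm// (le_trans (ltW c0)).
have aM x : `|extend k a x| <= M.
  have /andP[h1 h2] := extend_bounds ck ac x.
  by rewrite ger0_norm// (le_trans (ltW c0)).
have Ez : energy (extend k b) z z = energy e ya z.
  rewrite {1}zE (energy_comb mmb (extend_bounds ck bc) c0)// Eb// -Ea//.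
  by rewrite mulN1r addrC -(energyB ya z mmb mma bM aM).
have gz : grad_norm z <= d.+1%:R * delta * grad_norm ya / c.
  have [->|g0] := eqVneq (grad_norm z) 0.
    apply: divr_ge0; last exact: ltW.
    by apply: mulr_ge0; [exact: dd0|exact: grad_norm_ge0].
  have gp : 0 < grad_norm z by rewrite lt_def g0 grad_norm_ge0.
  apply: (ler_divl_sqr c0 gp).
  apply: (le_trans (energy_lower mmb (extend_bounds ck bc) c0 z)); rewrite Ez.
  by apply: (le_trans (ler_norm _)); exact: energy_norm_le.
rewrite -norm2_sub -zE; apply: (le_trans (HC _ hz)).
apply: (le_trans (ler_wpM2l (ltW C0) gz)).
have -> : d.+1%:R * delta * (C / c) ^+ 2 * N u =
    C * (d.+1%:R * delta * (C / c * N u) / c).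
  by move: (N u) => n; field; rewrite gt_eqF.
apply: ler_wpM2l; first exact: ltW.
apply: ler_wpM2r; first by rewrite invr_ge0 ltW.
by apply: ler_wpM2l; [exact: dd0|exact: ga].
Qed.

Lemma solution_operator_norm_le (a : 'rV[R]_d.+1 -> R) (c M k C : R) u :
  measurable_fun D a -> (forall x, D x -> c <= a x <= M) ->
  0 < c -> c <= k <= M ->
  0 < C -> (forall v, H10 v -> N v <= C * grad_norm v) ->
  N (solution_operator a u) <= C ^+ 2 / c * N u.
Proof.
move=> ma ac c0 ck C0 HC; have sa := solution_operatorP ma ac c0 ck u.
have ga := weak_solution_grad_le ma ac c0 ck C0 HC sa.
have [ha _] := sa; apply: (le_trans (HC _ ha)); rewrite expr2 -!mulrA.
by apply: ler_wpM2l; [exact: ltW|rewrite mulrA; exact: ga].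
Qed.

End solution_operator.

(** * Dependence of the optimal control on the coefficient *)

Opaque solution_operator comb.

(** Here [su], [sv], [sm] are squared distances of the states to the target, [nu], [nv], [nm]
    squared norms of the controls at u, v and their midpoint, and [ds], [dn] squared differences.
    The gap [ds] of the tracking term is dropped as nonnegative. *)
Lemma midpoint_gap (R : realFieldType) (al su sv sm ds nu nv nm dn : R) :
  sm = 2^-1 * su + 2^-1 * sv - 4^-1 * ds ->
  nm = 2^-1 * nu + 2^-1 * nv - 4^-1 * dn ->
  0 <= ds -> 2^-1 * su + al / 2 * nu <= 2^-1 * sm + al / 2 * nm ->
  al / 4 * dn <= 2^-1 * sv + al / 2 * nv - (2^-1 * su + al / 2 * nu).
Proof. by move=> -> -> ds0 h; lra. Qed.

Lemma ler_of_half_sum (R : realFieldType) (p q r s t : R) :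
  p <= q -> 0 <= r -> 2^-1 * r + s <= 2^-1 * p + t -> s <= 2^-1 * q + t.
Proof. by lra. Qed.

(** Used with p = J_a(u), q = J_b(u), r = J_a(v), s = J_b(v), where v minimizes J_b. *)
Lemma ler_sub_perturbed (R : realFieldType) (p q r s x : R) :
  `|p - q| <= x -> `|r - s| <= x -> s <= q -> r - p <= 2 * x.
Proof. by rewrite !ler_norml => /andP[? ?] /andP[? ?] ?; lra. Qed.

(** The inequality q <= q^2 + 1 replaces a square root. *)
Lemma ler_of_quadratic (R : realFieldType) (al q A : R) : 0 < al -> 0 <= q ->
  al / 2 * q ^+ 2 <= A -> q <= 2 * A / al + 1.
Proof.
move=> al0 q0 h; have h4 : q ^+ 2 <= 2 * A / al.
  by rewrite ler_pdivlMr//; move: h; move: (q ^+ 2) => r h; lra.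
by have : 0 <= (q - 2^-1) ^+ 2 := sqr_ge0 _; rewrite sqrrB; lra.
Qed.

Lemma small_perturbation (R : realFieldType) (c al e E : R) :
  0 < c -> 0 < al -> 0 < e -> 0 <= E ->
  exists delta : R, [/\ 0 < delta, delta <= c, delta <= 1 &
    forall n, 0 <= n -> al / 4 * n ^+ 2 <= 2 * (delta * E) -> n < e].
Proof.
move=> c0 al0 e0 E0; have E10 : 0 < 16 * (E + 1) by rewrite mulr_gt0// ltr_wpDl.
(* This gives 2 t E <= al e^2 / 8, strictly below al / 4 e^2; E + 1 allows for E = 0. *)
pose t := al * e ^+ 2 / (16 * (E + 1)).
have t0 : 0 < t by rewrite divr_gt0// mulr_gt0// exprn_gt0.
exists (Num.min c (Num.min 1 t)); split.
- by rewrite !lt_min c0 ltr01.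
- by rewrite ge_min lexx.
- by rewrite !ge_min lexx orbT.
move=> n n0 h; rewrite -(@ltr_pXn2r _ 2) ?nnegrE ?(ltW e0)//.
have h1 : Num.min c (Num.min 1 t) * E <= al * e ^+ 2 / 16.
  have -> : al * e ^+ 2 / 16 = t * (E + 1) by rewrite /t; field; rewrite gt_eqF// ltr_wpDl.
  apply: (@le_trans _ _ (t * E)); last by rewrite ler_pM2l// lerDl.
  by apply: ler_wpM2r => //; rewrite !ge_min lexx !orbT.
have a4 : 0 < al / 4 by rewrite divr_gt0.
rewrite -(ltr_pM2l a4); apply: (le_lt_trans h); rewrite [ltRHS]mulrAC.
have : 0 < al * e ^+ 2 by rewrite mulr_gt0// exprn_gt0.
by move: h1; move: (al * e ^+ 2) (Num.min _ _ * E) => p q; lra.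
Qed.

Section control.
Context (R : realType) (d : nat) (D : set 'rV[R]_d.+1).
Hypothesis hD : convex_polyhedral_domain D.
Local Notation nu := (lebesgue_on hD).
Local Notation L := (Lfun nu 2%:E).
Local Notation N := (norm2 nu).
Implicit Types (u v z : L2 hD) (a b : 'rV[R]_d.+1 -> R).

Let LL u : (u : 'rV[R]_d.+1 -> R) \in L := L2_Lfun u.

(** Written as (u - v) / 2 + v so that [solution_operator_comb] applies to it twice. *)
Definition midpoint u v : L2 hD := comb 2^-1 (comb (-1) v u) v.

Lemma midpointE u v : midpoint u v = (fun x => 2^-1 * (u x + v x)) %[ae nu].
Proof.
apply: filterS2 (combE 2^-1 (comb (-1) v u) v) (combE (-1) v u) => x H1 H2 xT.
by rewrite (H1 xT) (H2 xT); field.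
Qed.

Lemma norm2_half f g h : f \in L -> g \in L -> h \in L ->
  h = (fun x => 2^-1 * (f x + g x)) %[ae nu] ->
  N h ^+ 2 = 2^-1 * N f ^+ 2 + 2^-1 * N g ^+ 2 - 4^-1 * N (f \- g) ^+ 2.
Proof.
move=> fL gL hL hE; have fgL := Lfun2D fL gL.
rewrite (ae_eq_norm2 hL (Lfun2_scale 2^-1 fgL) hE) norm2Z//.
have E1 : N (f \+ g) ^+ 2 = N f ^+ 2 + 2 * inner nu f g + N g ^+ 2.
  rewrite !sqr_norm2 (innerDl fL gL fgL) (innerDr fL gL fL) (innerDr fL gL gL) (innerC nu g f).
  by move: (inner nu f f) (inner nu f g) (inner nu g g) => p q r; ring.
have E2 : N (f \- g) ^+ 2 = N f ^+ 2 - 2 * inner nu f g + N g ^+ 2.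
  have gfL := Lfun2B fL gL.
  rewrite !sqr_norm2 (innerBl fL gL gfL) (innerBr fL gL fL) (innerBr fL gL gL) (innerC nu g f).
  by move: (inner nu f f) (inner nu f g) (inner nu g g) => p q r; ring.
rewrite ger0_norm ?invr_ge0// exprMn E1 E2.
by move: (N f ^+ 2) (inner nu f g) (N g ^+ 2) => p q r; field.
Qed.

Lemma admissible_midpoint (ua ub : \bar R) u v : admissible ua ub u -> admissible ua ub v ->
  admissible ua ub (midpoint u v).
Proof.
rewrite /admissible /= => hu hv; apply: filterS3 (midpointE u v) hu hv => x H hu hv.
rewrite (H I).
move: hu hv; move: (u x) (v x) => s t /andP[s1 s2] /andP[t1 t2].
apply/andP; split.
  case: ua s1 t1 => [r| |]//; rewrite ?lee_fin ?leNye//; lra.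
by case: ub s2 t2 => [r| |]//; rewrite ?lee_fin ?leey//; lra.
Qed.

Lemma costE a z (alpha : R) u : cost a z alpha u =
  2^-1 * N (solution_operator a u \- z) ^+ 2 + alpha / 2 * N u ^+ 2.
Proof. by rewrite /cost !L2normE// Lfun2B. Qed.

Lemma optimal_control_gap (ua ub : \bar R) a (c M k alpha : R) z u v :
  measurable_fun D a -> (forall x, D x -> c <= a x <= M) -> 0 < c -> c <= k <= M ->
  0 < alpha -> optimal_control ua ub a z alpha u -> admissible ua ub v ->
  alpha / 4 * N (u \- v) ^+ 2 <= cost a z alpha v - cost a z alpha u.
Proof.
move=> ma ac c0 ck al0 [hu optu] hv.
have := optu _ (admissible_midpoint hu hv); rewrite !costE.
have Lz (w : L2 hD) : (solution_operator a w \- z) \in L by exact: Lfun2B (LL _) (LL _).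
have Sm : solution_operator a (midpoint u v) \- z =
    (fun x => 2^-1 * ((solution_operator a u \- z) x + (solution_operator a v \- z) x)) %[ae nu].
  rewrite /midpoint !(solution_operator_comb ma ac c0 ck).
  apply: filterS (midpointE (solution_operator a u) (solution_operator a v)) => x H xT /=.
  by rewrite (H I); field.
have h1 := norm2_half (Lz u) (Lz v) (Lz (midpoint u v)) Sm.
have h2 := norm2_half (LL u) (LL v) (LL (midpoint u v)) (midpointE u v).
exact: midpoint_gap h1 h2 (sqr_ge0 _).
Qed.

Lemma norm2_sqr_dist f g : f \in L -> g \in L ->
  `|N f ^+ 2 - N g ^+ 2| <= N (f \- g) * (N f + N g).
Proof.
move=> fL gL; rewrite subr_sqr normrM ler_pM ?normr_ge0//.
  have sK (p q : 'rV[R]_d.+1 -> R) : (p \- q) \+ q = p.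
    by apply/funext => x /=; rewrite subrK.
  rewrite ler_distlC; apply/andP; split.
    by have := norm2D (Lfun2B fL gL) gL; rewrite sK lerBlDl.
  by have := norm2D (Lfun2B gL fL) fL; rewrite sK (norm2BC gL fL) addrC.
by rewrite ger0_norm// addr_ge0// norm2_ge0.
Qed.

Lemma half_sqr_norm2_dist f g (t X Y : R) : f \in L -> g \in L ->
  N (f \- g) <= X -> N f <= Y -> N g <= Y ->
  `|2^-1 * N f ^+ 2 + t - (2^-1 * N g ^+ 2 + t)| <= X * Y.
Proof.
move=> fL gL h hf hg; have h1 := norm2_sqr_dist fL gL.
have n0 := norm2_ge0 nu (f \- g).
have nf := norm2_ge0 nu f; have ng := norm2_ge0 nu g.
move: h h1 n0 hf hg nf ng; move: (N (f \- g)) (N f) (N g) => p q r.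
move=> h h1 n0 hf hg nf ng.
have -> : 2^-1 * q ^+ 2 + t - (2^-1 * r ^+ 2 + t) = 2^-1 * (q ^+ 2 - r ^+ 2) by ring.
rewrite normrM ger0_norm ?invr_ge0//.
have h2 : p * (q + r) <= X * (2 * Y) by apply: ler_pM => //; lra.
have := le_trans h1 h2; lra.
Qed.

Lemma cost_perturbation a b (c M k delta C alpha W : R) z u :
  measurable_fun D a -> measurable_fun D b ->
  (forall x, D x -> c <= a x <= M) -> (forall x, D x -> c <= b x <= M) ->
  0 < c -> c <= k <= M -> (forall x, D x -> `|a x - b x| <= delta) ->
  0 < C -> (forall v : L2 hD, H10 v -> N v <= C * grad_norm v) -> N u <= W ->
  `|cost a z alpha u - cost b z alpha u| <=
  d.+1%:R * delta * (C / c) ^+ 2 * W * (C ^+ 2 / c * W + N z).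
Proof.
move=> ma mb ac bc c0 ck ab C0 HC uW; rewrite !costE.
have W0 : 0 <= W := le_trans (norm2_ge0 _ _) uW.
have h2 : N (solution_operator a u \- solution_operator b u) <=
    d.+1%:R * delta * (C / c) ^+ 2 * W.
  have h := weak_solution_perturbation ma mb ac bc c0 ck ab C0 HC
    (solution_operatorP ma ac c0 ck u) (solution_operatorP mb bc c0 ck u).
  apply: (le_trans h); apply: ler_wpM2l; last exact: uW.
  have [x0 Dx0] : D !=set0 by have [] := hD.
  have d0 : 0 <= delta := le_trans (normr_ge0 _) (ab _ Dx0).
  by apply: mulr_ge0; [exact: mulr_ge0|exact: sqr_ge0].
have h3 e (me : measurable_fun D e) (ec : forall x, D x -> c <= e x <= M) :
    N (solution_operator e u \- z) <= C ^+ 2 / c * W + N z.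
  have h := norm2D (LL (solution_operator e u)) (Lfun2N (LL z)).
  apply: (le_trans h); apply: lerD; last by rewrite norm2N.
  apply: (le_trans (solution_operator_norm_le u me ec c0 ck C0 HC)).
  by apply: ler_wpM2l; [rewrite divr_ge0 ?sqr_ge0 ?ltW|exact: uW].
have E : (solution_operator a u \- z) \- (solution_operator b u \- z) =
    solution_operator a u \- solution_operator b u.
  by apply/funext => x /=; rewrite opprB addrA subrK.
have paL := Lfun2B (LL (solution_operator a u)) (LL z).
have pbL := Lfun2B (LL (solution_operator b u)) (LL z).
apply: (half_sqr_norm2_dist _ paL pbL); [|exact: h3 ma ac|exact: h3 mb bc].
by rewrite E; exact: h2.
Qed.

Lemma optimal_control_continuous (ua ub : \bar R) a (c M alpha e : R) z u :
  measurable_fun D a -> (forall x, D x -> c <= a x <= M) -> 0 < c -> 0 < alpha ->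
  optimal_control ua ub a z alpha u -> 0 < e ->
  exists2 delta : R, 0 < delta & forall b v, measurable_fun D b ->
    (forall x, D x -> `|a x - b x| <= delta) ->
    optimal_control ua ub b z alpha v -> N (v \- u) < e.
Proof.
move=> ma ac c0 al0 ou e0.
have [C C0 HC] := poincare_grad hD.
have [x0 Dx0] : D !=set0 by have [] := hD.
have cM : c <= M by have /andP[h1 h2] := ac _ Dx0; exact: le_trans h1 h2.
have [c' [c'0 c'c cc']] : exists c' : R, [/\ 0 < c', c' <= c & c' + c' = c].
  by exists (c / 2); split; lra.
have ck : c' <= c <= M + 1 by apply/andP; split; lra.
have K0 : 0 <= C ^+ 2 / c' by rewrite divr_ge0 ?sqr_ge0 ?ltW.
have nv0 v : 0 <= N v := norm2_ge0 nu v.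
have B0 w : 0 <= w -> 0 <= C ^+ 2 / c' * w + N z.
  by move=> w0; apply: addr_ge0 (nv0 z); exact: mulr_ge0 K0 w0.
pose A0 := 2^-1 * (C ^+ 2 / c' * N u + N z) ^+ 2 + alpha / 2 * N u ^+ 2.
have [W uW AW] : exists2 W : R, N u <= W & 2 * A0 / alpha + 1 <= W.
  by exists (Num.max (N u) (2 * A0 / alpha + 1)); rewrite le_max lexx ?orbT.
have W0 : 0 <= W := le_trans (nv0 u) uW.
(* This is the bound of [cost_perturbation] without its factor delta; it depends on neither b nor
   v. *)
pose E := d.+1%:R * (C / c') ^+ 2 * W * (C ^+ 2 / c' * W + N z).
have E0 : 0 <= E.
  apply: mulr_ge0 (B0 _ W0); apply: mulr_ge0 W0.
  by apply: mulr_ge0 (sqr_ge0 _); exact: ler0n.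
have [delta [delta0 d1 d2 dE]] := small_perturbation c'0 al0 e0 E0.
exists delta => [//|b v mb ab ov].
have ac' x : D x -> c' <= a x <= M + 1.
  by move=> Dx; have /andP[h1 h2] := ac _ Dx; apply/andP; split; lra.
have bc' x : D x -> c' <= b x <= M + 1.
  move=> Dx; have /andP[h1 h2] := ac _ Dx; have := ab _ Dx; rewrite ler_norml => /andP[h3 h4].
  by apply/andP; split; lra.
have vW : N v <= W.
  have := ov.2 _ ou.1; rewrite !costE.
  have h : N (solution_operator b u \- z) <= C ^+ 2 / c' * N u + N z.
    have h := norm2D (LL (solution_operator b u)) (Lfun2N (LL z)).
    apply: (le_trans h); apply: lerD; last by rewrite norm2N.
    exact: solution_operator_norm_le u mb bc' c'0 ck C0 HC.
  have h' : N (solution_operator b u \- z) ^+ 2 <= (C ^+ 2 / c' * N u + N z) ^+ 2.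
    by apply: (lerXn2r 2 _ _ h); rewrite nnegrE; [exact: norm2_ge0|exact: B0 (nv0 u)].
  have s0 : 0 <= N (solution_operator b v \- z) ^+ 2 by exact: sqr_ge0.
  move=> h2; have h3 : alpha / 2 * N v ^+ 2 <= A0 := ler_of_half_sum h' s0 h2.
  exact: le_trans (ler_of_quadratic al0 (nv0 v) h3) AW.
have h1 := optimal_control_gap ma ac' c'0 ck al0 ou ov.1.
have dE0 : d.+1%:R * delta * (C / c') ^+ 2 * W * (C ^+ 2 / c' * W + N z) = delta * E.
  by rewrite /E; move: (N z) => n; ring.
have h2 := cost_perturbation alpha z ma mb ac' bc' c'0 ck ab C0 HC uW.
have h3 := cost_perturbation alpha z ma mb ac' bc' c'0 ck ab C0 HC vW.
rewrite dE0 in h2; rewrite dE0 in h3.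
have h5 := ler_sub_perturbed h2 h3 (ov.2 _ ou.1).
rewrite (norm2BC (LL v) (LL u)).
exact: dE (norm2_ge0 _ _) (le_trans h1 h5).
Qed.

End control.

(** * Separability of the space of coefficients *)

Section coefficients.
Context (R : realType) (d : nat).
Implicit Types (D : set 'rV[R]_d) (f g : 'rV[R]_d -> R).

Lemma closure_compact D : bounded_set D -> compact (closure D).
Proof.
move=> /bounded_set_cbox[M _ DM]; set K := cbox _ _ in DM.
have cK : compact K by exact: cbox_compact.
apply: (subclosed_compact (@closed_closure _ _) cK).
rewrite closureE; apply: smallest_sub DM.
by apply: compact_closed cK; exact: norm_hausdorff.
Qed.

Lemma within_closure_continuous D f : open D -> {within closure D, continuous f} ->
  forall x, D x -> {for x, continuous f}.
Proof.
move=> oD /(continuous_subspaceW (@subset_closure _ D)).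
by rewrite continuous_open_subspace// => cf x Dx; apply: cf; rewrite inE.
Qed.

Lemma amin_bounds D f : bounded_set D -> {within closure D, continuous f} ->
  exists M : R, forall x, closure D x -> amin D f <= f x <= M.
Proof.
move=> bD cf.
have [M [_ HM]] := compact_bounded (continuous_compact cf (closure_compact bD)).
have H x : closure D x -> `|f x| <= `|M| + 1.
  move=> Dx; apply: (HM (`|M| + 1)); last by exists x.
  by rewrite (le_lt_trans (ler_norm M))// ltrDl.
exists (`|M| + 1) => x Dx; have := H _ Dx; rewrite ler_norml => /andP[_ ->].
rewrite andbT; apply: ge_inf; last by exists x.
by exists (- (`|M| + 1)) => _ [y Dy <-]; have := H _ Dy; rewrite ler_norml => /andP[].
Qed.

(** Finite lists of rational boxes with a rational value on each: a countable substitute for a dense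
    set of coefficients. *)
Definition code : Type := seq ('rV[rat]_d * 'rV[rat]_d * rat).

Definition code_covers D (c : code) : Prop :=
  forall x, D x -> exists2 p, p \in c & box (map_mx ratr p.1.1) (map_mx ratr p.1.2) x.

(** Testing only at rational points makes this a countable conjunction of conditions on values of
    [f], hence an event when [f] is random. *)
Definition approximates D (e : R) (c : code) f : Prop :=
  forall p (r : 'rV[rat]_d), p \in c -> D (map_mx ratr r) ->
    box (map_mx ratr p.1.1) (map_mx ratr p.1.2) (map_mx ratr r : 'rV[R]_d) ->
    `|f (map_mx ratr r) - ratr p.2| <= e.

Lemma approximates_exists D e f : bounded_set D -> {within closure D, continuous f} ->
  0 < e -> exists c : code, code_covers D c /\ approximates D e c f.
Proof.
move=> bD cf e0; have e20 : 0 < e / 2 by rewrite divr_gt0.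
have := closure_compact bD; rewrite compact_cover.
pose I : choiceType := ('rV[rat]_d * 'rV[rat]_d * rat)%type.
pose F (p : I) : set 'rV[R]_d := box (map_mx ratr p.1.1) (map_mx ratr p.1.2).
pose G : set I := [set p | forall y, closure D y -> F p y -> `|f y - ratr p.2| <= e].
case/(_ _ G F) => [p _|x Dx|c cG cD]; first exact: box_open.
  have /(_ _ Dx)/cvgrPdist_lt/(_ _ e20) := (subspace_continuousP (closure D) f).1 cf.
  move=> /nbhs_rat_box[q [xq qA]].
  have [r] := @rat_in_itvoo R (f x - e / 2) (f x + e / 2) ltac:(lra).
  rewrite in_itv/= => /andP[r1 r2]; exists (q, r) => //= y Dy yq.
  have /(_ Dy) := qA y (fun i => ltac:(by have /andP[/ltW -> /ltW ->] := yq i)).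
  by rewrite ltr_norml ler_norml => /andP[h1 h2]; lra.
exists (finmap.enum_fset c); split=> [x /subset_closure/cD[p pc xp]|p r pc Dr].
  by exists p.
by have /set_mem := cG _ pc; apply; exact: subset_closure.
Qed.

Lemma rational_point_dense (A : set 'rV[R]_d) (x : 'rV[R]_d) : nbhs x A ->
  exists r : 'rV[rat]_d, A (map_mx ratr r).
Proof.
move=> /nbhs_rat_box[q [xq qA]]; exists q.1; apply: qA => i; rewrite lexx/=.
by have /andP[h1 h2] := xq i; exact: le_trans (ltW h1) (ltW h2).
Qed.

(** A strict violation at some x would persist in a neighbourhood, hence occur at a rational point
    of D in the same box, where both functions are within e of the same value. *)
Lemma approximates_close D e c f g : open D ->
  (forall x, D x -> {for x, continuous f}) -> (forall x, D x -> {for x, continuous g}) ->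
  code_covers D c -> approximates D e c f -> approximates D e c g ->
  forall x, D x -> `|f x - g x| <= 2 * e.
Proof.
move=> oD cf cg cD hf hg x Dx; have [p pc xp] := cD _ Dx.
rewrite leNgt; apply/negP => fg.
have c_fg : {for x, continuous (fun y => `|f y - g y|)}.
  exact: continuous_comp (cvgB (cf _ Dx) (cg _ Dx)) (@norm_continuous _ R^o _).
have A1 : nbhs x [set y | 2 * e < `|f y - g y|].
  have /c_fg// : nbhs `|f x - g x| [set t | 2 * e < t].
  by apply: open_nbhs_nbhs; split => //; exact: open_gt.
have A2 : nbhs x (box (map_mx ratr p.1.1) (map_mx ratr p.1.2)).
  by apply: open_nbhs_nbhs; split => //; exact: box_open.
have A3 : nbhs x D by exact: open_nbhs_nbhs.
have [r [[r1 r2] r3]] := rational_point_dense (filterI (filterI A1 A2) A3).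
have := hf _ _ pc r3 r2; have := hg _ _ pc r3 r2; move: r1 => /=.
move: (f _) (g _) (ratr p.2) => s t q; rewrite ltNge !ler_norml.
move=> /negP h1 /andP[h2 h3] /andP[h4 h5]; apply: h1.
by apply/andP; split; lra.
Qed.

(* [approximates_exists] and [approximates_close] express that the continuous
   functions are separable for the sup-norm, and [P] is open for it. *)
Lemma measurable_coefficient_open dO (T : measurableType dO) D (a : T -> 'rV[R]_d -> R)
    (O P : set T) : convex_polyhedral_domain D ->
  (forall w, {within closure D, continuous (a w)}) ->
  (forall x, D x -> measurable_fun setT (a ^~ x)) ->
  measurable O -> P `<=` O ->
  (forall w, P w -> exists2 delta : R, 0 < delta &
    forall w', O w' -> (forall x, D x -> `|a w x - a w' x| <= delta) -> P w') ->
  measurable P.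
Proof.
move=> hD ca ma mO PO hP; have oD := polyhedral_open hD; have [_ bD _] := hD.
pose E (k : code * nat) := O `&` [set w | approximates D (k.2.+1%:R^-1) k.1 (a w)].
have mE k : measurable (E k).
  apply: measurableI => //.
  pose F (q : 'rV[rat]_d * 'rV[rat]_d * rat * 'rV[rat]_d) : set T :=
    [set w | q.1 \in k.1 -> D (map_mx ratr q.2) ->
      box (map_mx ratr q.1.1.1) (map_mx ratr q.1.1.2) (map_mx ratr q.2 : 'rV[R]_d) ->
      `|a w (map_mx ratr q.2) - ratr q.1.2| <= k.2.+1%:R^-1].
  rewrite (_ : [set w | _] = \bigcap_q F q); last first.
    by apply/seteqP; split=> [w h [p r] _ /=|w h p r]; [exact: h|exact: (h (p, r))].
  rewrite -[\bigcap_q F q]setCK setC_bigcap; apply: measurableC.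
  apply: countable_bigcupT_measurable => [|q]; first exact: countableP.
  apply: measurableC.
  (* The three premises do not involve w: either all hold and [F q] is a single inequality, or [F q]
     is the whole space. *)
  have [[qk Dq bq]|nq] := pselect [/\ q.1 \in k.1, D (map_mx ratr q.2) &
      box (map_mx ratr q.1.1.1) (map_mx ratr q.1.1.2) (map_mx ratr q.2 : 'rV[R]_d)];
    last first.
    rewrite (_ : F q = setT)//; apply/seteqP; split=> // w _ qk Dq bq.
    by exfalso; exact: nq.
  have mf : measurable_fun setT (fun w => `|a w (map_mx ratr q.2) - ratr q.1.2|).
    by apply: measurableT_comp => //; apply: measurable_funB => //; exact: ma.
  rewrite (_ : F q = (fun w => `|a w (map_mx ratr q.2) - ratr q.1.2|) @^-1`
      `]-oo, k.2.+1%:R^-1]%classic).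
    by rewrite -[X in measurable X]setTI; exact: mf.
  by apply/seteqP; split=> w /=; rewrite in_itv/= => h; [exact: h|move=> _ _ _].
rewrite (_ : P = \bigcup_(k in [set k | code_covers D k.1 /\ E k `<=` P]) E k).
  rewrite bigcup_mkcond; apply: countable_bigcupT_measurable; first exact: countableP.
  by move=> k; case: ifPn.
apply/seteqP; split=> [w Pw|w [k [_ kP]]]; last exact: kP.
have [delta d0 hd] := hP _ Pw.
(* The factor 2 is the one lost in [approximates_close]. *)
have [n hn] : exists n : nat, 2 * n.+1%:R^-1 <= delta.
  exists (Num.trunc (2 / delta)); rewrite ler_pdivrMr// -ler_pdivrMl// mulrC.
  exact: ltW (truncnS_gt _).
have n0 : 0 < n.+1%:R^-1 :> R by rewrite invr_gt0.
have [c [cD cw]] := approximates_exists bD (ca w) n0.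
exists (c, n); last by split=> /=; [exact: PO|exact: cw].
split=> //= w' [Ow' cw']; apply: (hd _ Ow') => x Dx; apply: le_trans hn.
by apply: (approximates_close oD) cD cw cw' _ Dx; exact: within_closure_continuous.
Qed.

End coefficients.

(** * Measurability of the optimal control *)

Lemma amin_inv_itv (R : realType) (d : nat) (D : set 'rV[R]_d) (f : 'rV[R]_d -> R) :
  (0 < amin_inv D f < +oo)%E = (0 < amin D f).
Proof.
rewrite /amin_inv inver; have [->|n0] := eqVneq (amin D f) 0; first by rewrite ltxx andbF.
by rewrite ltry andbT lte_fin invr_gt0.
Qed.

Theorem theorem3p4 (R : realType)
    (dO : measure_display) (Omega : measurableType dO) (P : probability Omega R)
    (d : nat) (hd : (1 <= d <= 3)%N)
    (D : set 'rV[R]_d) (hD : convex_polyhedral_domain D)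
    (a : Omega -> 'rV[R]_d -> R)
    (hA : @measurable dO Omega =
      <<s [set E | exists x (B : set R),
             [/\ D x, measurable B & E = (fun w => a w x) @^-1` B]] >>)
    (A1_ge0 : {ae P, forall w, 0 <= amin D (a w)})
    (A1_inv : forall p : R, 1 <= p ->
      measurable_fun [set: Omega] (fun w => amin_inv D (a w)) /\
      ('N[P]_(p%:E) [(fun w => amin_inv D (a w))] < +oo)%E)
    (A2 : exists2 t : R, 0 < t <= 1 & forall p : R, 1 <= p ->
      bochner P (Ct_space D t) (Ct_norm D t) p a)
    (ua ub : \bar R) (hab : (ua <= ub)%E)
    (z : L2 hD) (alpha : R) (halpha : 0 < alpha)
    (u0 : L2 hD) (hu0 : admissible ua ub u0)
    (ustar : Omega -> L2 hD)
    (hsol : forall w, 0 < amin D (a w) ->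
      optimal_control ua ub (a w) z alpha (ustar w))
    (hexc : forall w, amin D (a w) <= 0 -> ustar w = u0) :
  forall B : set (L2 hD), L2borel B -> measurable (ustar @^-1` B).
Proof.
(* The bound 1 <= d excludes dimension 0 and provides the first coordinate for the Poincare
   inequality. *)
case: d hd D hD a hA A1_ge0 A1_inv A2 z u0 hu0 ustar hsol hexc => [//|d] _ D hD a hA _ A1_inv.
move=> [t _ A2] z u0 hu0 ustar hsol hexc.
have [Ca _ _] := A2 1 (lexx 1).
have ca w : {within closure D, continuous (a w)} by have [] := Ca w.
have ma x : D x -> measurable_fun setT (a ^~ x).
  move=> Dx _ B mB; rewrite setTI hA; apply: sub_sigma_algebra.
  by exists x, B.
have oD := polyhedral_open hD; have [_ bD _] := hD.
pose O := [set w | 0 < amin D (a w)].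
have mO : measurable O.
  have [mi _] := A1_inv 1 (lexx 1).
  (* Positivity of [amin] is read off from its measurable inverse: the value 0 is sent to +oo, which
     the open interval excludes. *)
  rewrite (_ : O = (fun w => amin_inv D (a w)) @^-1` `]0%E, +oo%E[%classic).
    by rewrite -[X in measurable X]setTI; apply: mi => //; exact: emeasurable_itv.
  by apply/seteqP; split=> w; rewrite /= in_itv/= amin_inv_itv.
have mU U : L2open U -> measurable (ustar @^-1` U).
  move=> oU.
  have mP : measurable (O `&` ustar @^-1` U).
    apply: (measurable_coefficient_open hD ca ma mO) => [w []//|w [Ow Uw]].
    have [M aM] := amin_bounds bD (ca w).
    have [e e0 eU] := oU _ Uw.
    have meas w' : measurable_fun D (a w').
      apply: (continuous_measurable_rV oD).
      exact: within_closure_continuous oD (ca w').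
    have [delta d0 hd] := optimal_control_continuous (meas w)
      (fun x Dx => aM x (subset_closure Dx)) Ow halpha (hsol _ Ow) e0.
    exists delta => // w' Ow' aw'; split=> //.
    apply: eU; rewrite L2normE; last exact: Lfun2B (L2_Lfun _) (L2_Lfun _).
    exact: hd (meas w') aw' (hsol _ Ow').
  (* Off [O] the control is constantly [u0], so the preimage of [U] contains either all or none of
     the complement of [O]. *)
  have [Uu0|nUu0] := pselect (U u0).
    rewrite (_ : _ @^-1` _ = ~` O `|` (O `&` ustar @^-1` U)).
      by apply: measurableU => //; exact: measurableC.
    apply/seteqP; split=> [w Uw|w [nO|[]//]].
      by have [Ow|nO] := pselect (O w); [right|left].
    by rewrite /= hexc// leNgt; apply/negP.
  rewrite (_ : _ @^-1` _ = O `&` ustar @^-1` U)//.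
  apply/seteqP; split=> [w Uw|w []//]; split=> //.
  rewrite /O /= ltNge; apply/negP => /hexc E; apply: nUu0.
  by move: Uw; rewrite /= E.
move=> B BB; pose S : set (set (L2 hD)) := [set A | measurable (ustar @^-1` A)].
suff : @L2borel _ _ _ hD `<=` S by apply.
apply: smallest_sub => //; split => /=.
- by rewrite /S /= preimage_set0.
- by move=> A; rewrite /S /= setTD; exact: measurableC.
- by move=> F mF; rewrite /S /= preimage_bigcup; exact: bigcupT_measurable.
Qed.
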